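(* Let $1\le m\le n$ and ${\cal B}=\{m+1,\dots,n\}$. For $1\le i,j\le m$ put $\widetilde t_{ij}(u)=t^{\,i,m+1,\dots,n}_{\,j,m+1,\dots,n}(u)\in \mathrm{Y}(n)[[u^{-1}]]$ and $\widetilde T(u)=(\widetilde t_{ij}(u))_{i,j=1}^m$. Then the mapping $$t_{ij}(u)\mapsto \widetilde t_{ij}(u),\qquad 1\le i,j\le m,$$ defines an algebra homomorphism $\mathrm{Y}(m)\to \mathrm{Y}(n)$. Moreover, one has the identity $$\mathrm{qdet}\,\widetilde T(u)=\mathrm{qdet}\,T(u)\;\mathrm{qdet}\,T(u-1)_{{\cal B}{\cal B}}\;\cdots\;\mathrm{qdet}\,T(u-m+1)_{{\cal B}{\cal B}}$$ (for $m=1$ the right-hand side is just $\mathrm{qdet}\,T(u)$).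
   Context: The Yangian $\mathrm{Y}(n)=\mathrm{Y}(\mathfrak{gl}(n))$ is the complex unital associative algebra with generators $t_{ij}^{(r)}$, $r\ge 1$, $1\le i,j\le n$, and defining relations $$[t_{ij}(u),t_{kl}(v)]=\frac{1}{u-v}\bigl(t_{kj}(u)t_{il}(v)-t_{kj}(v)t_{il}(u)\bigr),$$ where $t_{ij}(u)=\delta_{ij}+t_{ij}^{(1)}u^{-1}+t_{ij}^{(2)}u^{-2}+\cdots\in \mathrm{Y}(n)[[u^{-1}]]$, and $u,v$ are formal variables (equivalently, the identity holds after multiplication by $u-v$). Put $T(u)=(t_{ij}(u))_{i,j=1}^n$. A series in $(u-c)^{-1}$, $c\in\mathbb{C}$, is re-expanded as a series in $u^{-1}$. For indices $a_1,\dots,a_s,b_1,\dots,b_s\in\{1,\dots,n\}$ the quantum minor is $$t^{a_1\cdots a_s}_{b_1\cdots b_s}(u)=\sum_{\sigma\in\mathfrak{S}_s}\mathrm{sgn}(\sigma)\,t_{a_{\sigma(1)}b_1}(u)\,t_{a_{\sigma(2)}b_2}(u-1)\cdots t_{a_{\sigma(s)}b_s}(u-s+1).$$ The quantum determinant of an $N\times N$ matrix $X(u)=(x_{ij}(u))$ of series is $\mathrm{qdet}\,X(u)=\sum_{p\in\mathfrak{S}_N}\mathrm{sgn}(p)\,x_{p(1)1}(u)\,x_{p(2)2}(u-1)\cdots x_{p(N)N}(u-N+1)$. In particular $\mathrm{qdet}\,T(u)=t^{1\cdots n}_{1\cdots n}(u)$. $T(u)_{{\cal B}{\cal B}}$ is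 the submatrix of $T(u)$ with rows and columns indexed by ${\cal B}$ (in increasing order), so $\mathrm{qdet}\,T(u)_{{\cal B}{\cal B}}=t^{m+1\cdots n}_{m+1\cdots n}(u)$; the quantum determinant of an empty matrix is $1$. *)

(* Defs.v *)
From HB Require Import structures.
From mathcomp Require Import all_boot all_algebra all_fingroup.
From mathcomp Require Import generic_quotient ring_quotient.
From mathcomp Require Import boolp reals complex monalg.

Set Implicit Arguments.
Unset Strict Implicit.
Unset Printing Implicit Defensive.

Import GRing.Theory.
Local Open Scope ring_scope.
Local Open Scope quotient_scope.

(* The ring A[[u^-1]]: [f r] is the coefficient of u^-r. *)

Record pseries (A : Type) := PSeries { pcoef :> nat -> A }.

Lemma pseriesP (A : Type) (f g : pseries A) : (forall r, f r = g r) -> f = g.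
Proof. by case: f g => [f] [g] /= fg; congr PSeries; exact/funext. Qed.

HB.instance Definition _ (A : Type) := gen_eqMixin (pseries A).
HB.instance Definition _ (A : Type) := gen_choiceMixin (pseries A).

Definition map_pseries (A B : Type) (phi : A -> B) (f : pseries A) :=
  PSeries (fun r => phi (f r)).

Section SeriesRing.
Variable A : nzRingType.
Implicit Types f g h : pseries A.

Definition pszero : pseries A := PSeries (fun=> 0).
Definition psone : pseries A := PSeries (fun r => (r == 0)%:R).
Definition psopp f := PSeries (fun r => - f r).
Definition psadd f g := PSeries (fun r => f r + g r).
Definition psmul f g := PSeries (fun r => \sum_(i < r.+1) f i * g (r - i)%N).

Fact psaddA : associative psadd.
Proof. by move=> f g h; apply: pseriesP => r /=; rewrite addrA. Qed.
Fact psaddC : commutative psadd.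
Proof. by move=> f g; apply: pseriesP => r /=; rewrite addrC. Qed.
Fact psadd0 : left_id pszero psadd.
Proof. by move=> f; apply: pseriesP => r /=; rewrite add0r. Qed.
Fact psaddN : left_inverse pszero psopp psadd.
Proof. by move=> f; apply: pseriesP => r /=; rewrite addNr. Qed.

HB.instance Definition _ :=
  GRing.isZmodule.Build (pseries A) psaddA psaddC psadd0 psaddN.

Let trunc N f : {poly A} := \poly_(i < N) f i.

Let psmul_trunc N f g r : (r < N)%N -> psmul f g r = (trunc N f * trunc N g)`_r.
Proof.
move=> rN; rewrite coefM; apply: eq_bigr => -[i /= ir] _.
rewrite !coef_poly (leq_trans ir) // (leq_ltn_trans (leq_subr _ _) rN).
by [].
Qed.

Fact psmulA : associative psmul.
Proof.
move=> f g h; apply: pseriesP => r.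
transitivity ((trunc r.+1 f * (trunc r.+1 g * trunc r.+1 h))`_r).
  rewrite coefM; apply: eq_bigr => i _.
  by rewrite coef_poly ltn_ord -psmul_trunc // ltnS leq_subr.
rewrite mulrA coefM; apply: eq_bigr => i _.
by rewrite coef_poly -psmul_trunc // ltnS leq_subr.
Qed.
Fact psmul1 : left_id psone psmul.
Proof.
move=> f; apply: pseriesP => r /=.
rewrite big_ord_recl /= mul1r subn0 big1 ?addr0 // => i _.
by rewrite /= mul0r.
Qed.
Fact psmulr1 : right_id psone psmul.
Proof.
move=> f; apply: pseriesP => r /=.
rewrite big_ord_recr /= subnn mulr1 big1 ?add0r // => i _.
by rewrite subn_eq0 leqNgt ltn_ord mulr0.
Qed.
Fact psmulDl : left_distributive psmul psadd.
Proof.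
move=> f g h; apply: pseriesP => r /=.
by rewrite -big_split; apply: eq_bigr => i _; rewrite mulrDl.
Qed.
Fact psmulDr : right_distributive psmul psadd.
Proof.
move=> f g h; apply: pseriesP => r /=.
by rewrite -big_split; apply: eq_bigr => i _; rewrite mulrDr.
Qed.
Fact psone_neq0 : psone != pszero.
Proof.
by apply/eqP => /(congr1 (fun f : pseries A => f 0)) /eqP; rewrite /= oner_eq0.
Qed.

HB.instance Definition _ := GRing.Zmodule_isNzRing.Build (pseries A)
  psmulA psmul1 psmulr1 psmulDl psmulDr psone_neq0.

End SeriesRing.

(* The expansion u^-1 + c u^-2 + c^2 u^-3 + ... of (u - c)^-1. *)
Definition inv_shift (K : nzRingType) (c : K) : pseries K :=
  PSeries (fun r => if r is r'.+1 then c ^+ r' else 0).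

Section QuantumDeterminant.
Variables (K : comNzRingType) (A : algType K).

(* The series f(u - c) = \sum_r f_r (u - c)^-r, re-expanded in u^-1; since
   (u - c)^-r starts at u^-r, the terms r > s do not contribute to u^-s. *)
Definition shift (c : K) (f : pseries A) : pseries A :=
  PSeries (fun s => \sum_(r < s.+1) (inv_shift c ^+ r) s *: f r).

Definition qdet (N : nat) (X : 'M[pseries A]_N) : pseries A :=
  \sum_(p : 'S_N) (-1) ^+ p * \prod_(k < N) shift k%:R (X (p k) k).

Definition qminor (n s : nat) (X : 'M[pseries A]_n) (a b : 'I_s -> 'I_n) :
    pseries A :=
  qdet (mxsub a b X).

End QuantumDeterminant.

(* The coefficient of u^-r v^-s in
     (u - v) [t_ij(u), t_kl(v)] - (t_kj(u) t_il(v) - t_kj(v) t_il(u)).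
   The first bracket also has terms in u v^-s and u^-r v, with coefficients
   [t_ij^(0), t_kl^(s)] and [t_ij^(r), t_kl^(0)]; they vanish when
   t_ij^(0) = delta_ij. *)
Definition yangian_rel (A : nzRingType) (n : nat) (t : 'M[pseries A]_n)
    (i j k l : 'I_n) (r s : nat) : A :=
  (t i j r.+1 * t k l s - t k l s * t i j r.+1)
  - (t i j r * t k l s.+1 - t k l s.+1 * t i j r)
  - (t k j r * t i l s - t k j s * t i l r).

Lemma rmorph_yangian_rel (A B : nzRingType) (phi : {rmorphism A -> B}) (n : nat)
    (t : 'M[pseries A]_n) (i j k l : 'I_n) (r s : nat) :
  phi (yangian_rel t i j k l r s) =
  yangian_rel (map_mx (map_pseries phi) t) i j k l r s.
Proof. by rewrite /yangian_rel !mxE /= !rmorphB !rmorphM. Qed.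

Definition two_sided_ideal (A : nzRingType) (I : A -> Prop) : Prop :=
  [/\ I 0, forall x y, I x -> I y -> I (x + y),
      forall a x, I x -> I (a * x) & forall a x, I x -> I (x * a)].

Section Yangian.
Variables (K : comNzRingType) (n : nat).

(* (r, i, j) stands for the generator t_ij^(r+1). *)
Definition yangian_index : Type := nat * 'I_n * 'I_n.
HB.instance Definition _ := Choice.on yangian_index.

Definition free_yangian : Type := {malg K[{fmonom yangian_index}]}.
HB.instance Definition _ := GRing.Lalgebra.on free_yangian.

Fact free_yangian_scalerAr (c : K) (x y : free_yangian) :
  c *: (x * y) = x * (c *: y).
Proof.
have mulC (z : free_yangian) : z * malgC c = malgC c * z.
  rewrite [LHS](fgmulgU (R := K)) [RHS](fgmulUg (R := K)).
  by apply: eq_bigr => k _; rewrite mulrC mulm1 mul1m.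
have scaleE (z : free_yangian) : c *: z = malgC c * z.
  exact: esym (mul_malgC _ _).
by rewrite !scaleE mulrA -mulC -mulrA.
Qed.
HB.instance Definition _ :=
  GRing.Lalgebra_isAlgebra.Build K free_yangian free_yangian_scalerAr.

Definition free_gen (i j : 'I_n) (r : nat) : free_yangian :=
  if r is r'.+1 then << 1 *g fmu ((r', i, j) : yangian_index) >>
  else (i == j)%:R.

Definition free_mx : 'M[pseries free_yangian]_n :=
  \matrix_(i, j) PSeries (free_gen i j).

Definition yangian_ideal : pred free_yangian := fun x =>
  `[< forall I : free_yangian -> Prop, two_sided_ideal I ->
        (forall i j k l r s, I (yangian_rel free_mx i j k l r s)) -> I x >].

Fact yangian_ideal_two_sided : two_sided_ideal yangian_ideal.
Proof.
split=> [|x y|a x|a x].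
- by apply/asboolP => I [].
- move=> /asboolP Ix /asboolP Iy; apply/asboolP => I HI HR.
  by case: (HI) => _ + _ _; apply; [exact: Ix | exact: Iy].
- move=> /asboolP Ix; apply/asboolP => I HI HR.
  by case: (HI) => _ _ + _; apply; exact: Ix.
- move=> /asboolP Ix; apply/asboolP => I HI HR.
  by case: (HI) => _ _ _; apply; exact: Ix.
Qed.

Fact yangian_ideal_zmod_closed : zmod_closed yangian_ideal.
Proof.
case: yangian_ideal_two_sided => I0 ID IMl _; split=> // x y Ix Iy.
by rewrite -[- y]mulN1r; apply: ID => //; exact: IMl.
Qed.
HB.instance Definition _ :=
  GRing.isZmodClosed.Build free_yangian yangian_ideal yangian_ideal_zmod_closed.

Definition augmentation : free_yangian -> K := mcoeff mone.
HB.instance Definition _ := GRing.RMorphism.copy augmentation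
  (mcoeff mone : {malg K[{fmonom yangian_index}]} -> K).

Fact yangian_ideal1 : 1 \notin yangian_ideal.
Proof.
have epsI : two_sided_ideal (fun x => augmentation x = 0).
  split=> [|x y ex ey|a x ex|a x ex]; first exact: rmorph0.
  - by rewrite (rmorphD augmentation) /= ex ey addr0.
  - by rewrite (rmorphM augmentation) /= ex mulr0.
  - by rewrite (rmorphM augmentation) /= ex mul0r.
apply/negP => /asboolP /(_ _ epsI); rewrite rmorph1 => H.
suff /H/eqP : forall i j k l r s,
    augmentation (yangian_rel free_mx i j k l r s) = 0 by rewrite oner_eq0.
move=> i j k l r s; rewrite rmorph_yangian_rel.
have epsT a b q : map_mx (map_pseries augmentation) free_mx a b q =
    ((a == b) && (q == 0))%:R.
  rewrite !mxE /=; case: q => [|q] /=; first by rewrite andbT rmorph_nat.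
  by rewrite andbF [LHS]mcoeffU1 [_ == _]fm1_eq1.
rewrite /yangian_rel !epsT /= !andbF.
by case: (r == 0)%N; case: (s == 0)%N;
  rewrite ?(andbF, andbT, mulr0, mul0r, subrr).
Qed.

Definition yangian : Type :=
  Quotient.quot (GRing.ZmodClosed.clone _ yangian_ideal _).
HB.instance Definition _ := GRing.Zmodule.on yangian.

Definition yangian_pi : free_yangian -> yangian := \pi_yangian.

Lemma yangian_pi_surj (x : yangian) : exists a, yangian_pi a = x.
Proof. by exists (repr x); exact: reprK. Qed.

Lemma yangian_pi_eq (a b : free_yangian) :
  yangian_pi a = yangian_pi b <-> a - b \in yangian_ideal.
Proof.
by split=> ab; [rewrite Quotient.idealrBE|]; apply/eqP;
  rewrite // -Quotient.idealrBE.
Qed.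

Fact yangian_pi_zmod_morphism : zmod_morphism yangian_pi.
Proof. by move=> a b; rewrite /yangian_pi !piE. Qed.
HB.instance Definition _ :=
  GRing.isZmodMorphism.Build free_yangian yangian yangian_pi
    yangian_pi_zmod_morphism.

Definition yangian_one : yangian := locked (yangian_pi 1).
Definition yangian_mul : yangian -> yangian -> yangian :=
  locked (fun x y => yangian_pi (repr x * repr y)).
Definition yangian_scale : K -> yangian -> yangian :=
  locked (fun c x => yangian_pi (c *: repr x)).

Let repr_pi a : repr (yangian_pi a) - a \in yangian_ideal.
Proof. by apply/yangian_pi_eq; exact: reprK. Qed.

Fact yangian_oneE : yangian_pi 1 = yangian_one.
Proof. by rewrite /yangian_one -lock. Qed.
Fact yangian_mulE a b :
  yangian_mul (yangian_pi a) (yangian_pi b) = yangian_pi (a * b).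
Proof.
have [_ ID IMl IMr] := yangian_ideal_two_sided.
rewrite /yangian_mul -lock; apply/yangian_pi_eq.
set a' := repr (yangian_pi a); set b' := repr (yangian_pi b).
have -> : a' * b' - a * b = a' * (b' - b) + (a' - a) * b.
  by rewrite mulrBr mulrBl addrA subrK.
by apply: ID; [apply: IMl | apply: IMr]; exact: repr_pi.
Qed.

Fact yangian_scaleE c a :
  yangian_scale c (yangian_pi a) = yangian_pi (c *: a).
Proof.
have [_ _ IMl _] := yangian_ideal_two_sided.
rewrite /yangian_scale -lock; apply/yangian_pi_eq; rewrite -scalerBr -mulr_algl.
by apply: IMl; exact: repr_pi.
Qed.

Fact yangian_mulA : associative yangian_mul.
Proof.
move=> x y z; have [a <-] := yangian_pi_surj x.
have [b <-] := yangian_pi_surj y; have [c <-] := yangian_pi_surj z.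
by rewrite !yangian_mulE mulrA.
Qed.
Fact yangian_mul1 : left_id yangian_one yangian_mul.
Proof.
by move=> x; have [a <-] := yangian_pi_surj x; rewrite -yangian_oneE yangian_mulE mul1r.
Qed.
Fact yangian_mulr1 : right_id yangian_one yangian_mul.
Proof.
by move=> x; have [a <-] := yangian_pi_surj x; rewrite -yangian_oneE yangian_mulE mulr1.
Qed.
Fact yangian_mulDl : left_distributive yangian_mul +%R.
Proof.
move=> x y z; have [a <-] := yangian_pi_surj x.
have [b <-] := yangian_pi_surj y; have [c <-] := yangian_pi_surj z.
by rewrite -raddfD !yangian_mulE -raddfD mulrDl.
Qed.
Fact yangian_mulDr : right_distributive yangian_mul +%R.
Proof.
move=> x y z; have [a <-] := yangian_pi_surj x.
have [b <-] := yangian_pi_surj y; have [c <-] := yangian_pi_surj z.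
by rewrite -raddfD !yangian_mulE -raddfD mulrDr.
Qed.
Fact yangian_one_neq0 : yangian_one != 0.
Proof.
apply/eqP; rewrite -yangian_oneE -[0](raddf0 yangian_pi) => /yangian_pi_eq.
by rewrite subr0; exact/negP/yangian_ideal1.
Qed.
HB.instance Definition _ := GRing.Zmodule_isNzRing.Build yangian
  yangian_mulA yangian_mul1 yangian_mulr1 yangian_mulDl yangian_mulDr
  yangian_one_neq0.

Fact yangian_pi_monoid_morphism : monoid_morphism yangian_pi.
Proof. split=> [|a b]; first exact: yangian_oneE.
exact: esym (yangian_mulE a b). Qed.
HB.instance Definition _ :=
  GRing.isMonoidMorphism.Build free_yangian yangian yangian_pi
    yangian_pi_monoid_morphism.
Let yangian_piM a b : yangian_pi (a * b) = yangian_pi a * yangian_pi b.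
Proof. exact: rmorphM. Qed.

Fact yangian_scaleA c d x :
  yangian_scale c (yangian_scale d x) = yangian_scale (c * d) x.
Proof.
by have [a <-] := yangian_pi_surj x; rewrite !yangian_scaleE scalerA.
Qed.
Fact yangian_scale1 : left_id 1 yangian_scale.
Proof.
by move=> x; have [a <-] := yangian_pi_surj x; rewrite yangian_scaleE scale1r.
Qed.
Fact yangian_scaleDr : right_distributive yangian_scale +%R.
Proof.
move=> c x y; have [a <-] := yangian_pi_surj x.
have [b <-] := yangian_pi_surj y.
by rewrite -raddfD !yangian_scaleE -raddfD scalerDr.
Qed.
Fact yangian_scaleDl x : {morph yangian_scale^~ x : c d / c + d}.
Proof.
move=> c d; have [a <-] := yangian_pi_surj x.
by rewrite !yangian_scaleE -raddfD scalerDl.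
Qed.
HB.instance Definition _ := GRing.Zmodule_isLmodule.Build K yangian
  yangian_scaleA yangian_scale1 yangian_scaleDr yangian_scaleDl.

Fact yangian_pi_scalable : scalable yangian_pi.
Proof. by move=> c a; exact: esym (yangian_scaleE c a). Qed.
HB.instance Definition _ :=
  GRing.isScalable.Build K free_yangian yangian *:%R yangian_pi
    yangian_pi_scalable.
Let yangian_piZ c a : yangian_pi (c *: a) = c *: yangian_pi a.
Proof. exact: yangian_pi_scalable. Qed.

Fact yangian_scaleAl (c : K) (x y : yangian) : c *: (x * y) = c *: x * y.
Proof.
have [a <-] := yangian_pi_surj x; have [b <-] := yangian_pi_surj y.
by rewrite -!(yangian_piM, yangian_piZ) scalerAl.
Qed.
HB.instance Definition _ :=
  GRing.Lmodule_isLalgebra.Build K yangian yangian_scaleAl.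

Fact yangian_scaleAr (c : K) (x y : yangian) : c *: (x * y) = x * (c *: y).
Proof.
have [a <-] := yangian_pi_surj x; have [b <-] := yangian_pi_surj y.
by rewrite -!(yangian_piM, yangian_piZ) scalerAr.
Qed.
HB.instance Definition _ :=
  GRing.Lalgebra_isAlgebra.Build K yangian yangian_scaleAr.

Definition yangian_mx : 'M[pseries yangian]_n :=
  map_mx (map_pseries yangian_pi) free_mx.

Lemma yangian_mx0 (i j : 'I_n) : yangian_mx i j 0 = (i == j)%:R.
Proof. by rewrite !mxE /= rmorph_nat. Qed.

Lemma yangian_relP (i j k l : 'I_n) (r s : nat) :
  yangian_rel yangian_mx i j k l r s = 0.
Proof.
rewrite -rmorph_yangian_rel -(raddf0 yangian_pi); apply/yangian_pi_eq.
by rewrite subr0; apply/asboolP => I _; apply.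
Qed.

Section Lift.
Variables (A : algType K) (t : 'M[pseries A]_n).

Definition free_lift_mon (m : {fmonom yangian_index}) : A :=
  \prod_(x <- (m : seq yangian_index)) t x.1.2 x.2 x.1.1.+1.

Fact free_lift_mon_mmorphism : mmorphism free_lift_mon.
Proof.
split=> [a b|]; last by rewrite /free_lift_mon fm1 big_nil.
by rewrite /free_lift_mon fmM big_cat.
Qed.
HB.instance Definition _ :=
  isMultiplicative.Build _ A free_lift_mon free_lift_mon_mmorphism.

Definition free_lift : free_yangian -> A :=
  mmap (in_alg A : K -> A) free_lift_mon.
HB.instance Definition _ := GRing.isZmodMorphism.Build free_yangian A free_lift
  (raddfB (mmap (in_alg A : K -> A) free_lift_mon)).
Fact free_lift_monoid_morphism : monoid_morphism free_lift.
Proof.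
have [] := @commr_mmap_is_multiplicative _ _ _ (in_alg A) free_lift_mon.
  by move=> g m m'; by rewrite /GRing.comm /= mulr_algl mulr_algr.
by [].
Qed.
HB.instance Definition _ := GRing.isMonoidMorphism.Build free_yangian A free_lift
  free_lift_monoid_morphism.
Fact free_lift_scalable : scalable free_lift.
Proof. by move=> c x; rewrite [LHS]mmapZ /= mulr_algl. Qed.
HB.instance Definition _ := GRing.isScalable.Build K free_yangian A *:%R free_lift
  free_lift_scalable.

End Lift.

Lemma yangian_lift (A : algType K) (t : 'M[pseries A]_n) :
  (forall i j, t i j 0 = (i == j)%:R) ->
  (forall i j k l r s, yangian_rel t i j k l r s = 0) ->
  exists phi : {lrmorphism yangian -> A},
    forall i j, map_pseries phi (yangian_mx i j) = t i j.
Proof.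
move=> t0 rel_t.
have t_gen i j : map_pseries (free_lift t) (free_mx i j) = t i j.
  apply: pseriesP => r; rewrite mxE /=; case: r => [|r] /=.
    by rewrite rmorph_nat t0.
  by rewrite [LHS]mmapU /= scale1r mul1r /free_lift_mon fmU big_seq1.
have lift0 a : a \in yangian_ideal -> free_lift t a = 0.
  move=> /asboolP /(_ (fun a => free_lift t a = 0)); apply=> [|i j k l r s].
    split=> [|x y x0 y0|b x x0|b x x0]; first exact: raddf0.
    - by rewrite (raddfD (free_lift t)) /= x0 y0 addr0.
    - by rewrite (rmorphM (free_lift t)) /= x0 mulr0.
    - by rewrite (rmorphM (free_lift t)) /= x0 mul0r.
  rewrite (rmorph_yangian_rel (free_lift t)) -[RHS](rel_t i j k l r s).
  by congr (yangian_rel _ i j k l r s); apply/matrixP => x y; rewrite mxE t_gen.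
pose phi (x : yangian) : A := free_lift t (repr x).
have phiE a : phi (yangian_pi a) = free_lift t a.
  apply/eqP; rewrite -subr_eq0 -(raddfB (free_lift t)); apply/eqP/lift0.
  exact: repr_pi.
have phiB : zmod_morphism phi.
  move=> x y; have [a <-] := yangian_pi_surj x.
  by have [b <-] := yangian_pi_surj y; rewrite -raddfB !phiE raddfB.
have phiM : monoid_morphism phi.
  split=> [|x y]; first by rewrite -(rmorph1 yangian_pi) phiE rmorph1.
  have [a <-] := yangian_pi_surj x; have [b <-] := yangian_pi_surj y.
  by rewrite -rmorphM !phiE rmorphM.
have phiZ : scalable phi.
  move=> c x; have [a <-] := yangian_pi_surj x.
  by rewrite -yangian_piZ !phiE linearZ.
pose ba := GRing.isZmodMorphism.Build yangian A phi phiB.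
pose bm := GRing.isMonoidMorphism.Build yangian A phi phiM.
pose bz := GRing.isScalable.Build K yangian A *:%R phi phiZ.
pose Phi : {lrmorphism yangian -> A} := HB.pack phi ba bm bz.
exists Phi => i j; apply: pseriesP => r; rewrite !mxE /= phiE.
by rewrite -t_gen mxE.
Qed.


Lemma yangian_hom_ext (A : algType K) (phi psi : {lrmorphism yangian -> A}) :
  (forall i j, map_pseries phi (yangian_mx i j) =
               map_pseries psi (yangian_mx i j)) ->
  phi =1 psi.
Proof.
move=> eq_gen.
suff eq_free (a : free_yangian) : phi (yangian_pi a) = psi (yangian_pi a).
  by move=> x; have [a <-] := yangian_pi_surj x.
have eqM (m : {fmonom yangian_index}) :
    phi (yangian_pi << m >>) = psi (yangian_pi << m >>).
  case: m => m; elim: m => [|[[r i] j] m IHm].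
    have -> : << FMonom [::] >> = 1 :> free_yangian.
      by congr << _ >>; apply/val_inj; rewrite /= fm1.
    by rewrite !rmorph1.
  have -> : << FMonom ((r, i, j) :: m) >> =
      free_gen i j r.+1 * << FMonom m >> :> free_yangian.
    rewrite [RHS](fgmulUU (R := K)) mulr1; congr << _ >>.
    by apply/val_inj; rewrite /= fmM fmU.
  rewrite yangian_piM (rmorphM phi) (rmorphM psi) /=; congr (_ * _); last exact: IHm.
  by have /(congr1 (fun f : pseries A => f r.+1)) := eq_gen i j; rewrite !mxE.
rewrite (monalgE a) !raddf_sum; apply: eq_bigr => m _ /=.
have -> : << a@_m *g m >> = a@_m *: << m >> :> free_yangian.
  by apply/malgP => k; rewrite mcoeffZ !mcoeffU mulr_natr.
by rewrite !linearZ /= eqM.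
Qed.



End Yangian.

Section Sylvester.
Variables (K : comNzRingType) (m n : nat) (lemn : (m <= n)%N).

(* The increasing enumeration of B = {m+1, ..., n}; 'I_n is 0-based, so B is
   {m, ..., n-1} here. *)
Definition B_index (k : 'I_(n - m)) : 'I_n :=
  cast_ord (subnKC lemn) (rshift m k).

Definition cons_B (i : 'I_m) (k : 'I_(n - m).+1) : 'I_n :=
  if unlift ord0 k is Some k' then B_index k' else widen_ord lemn i.

Definition yangian_BB : 'M[pseries (yangian K n)]_(n - m) :=
  mxsub B_index B_index (yangian_mx K n).

Definition sylvester_mx : 'M[pseries (yangian K n)]_m :=
  \matrix_(i, j) qminor (yangian_mx K n) (cons_B i) (cons_B j).

End Sylvester.

(* Main.v *)
(* The map T |-> (T^-1)^tr and the map T |-> (T^tr)^-1 both preserve the RTT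
   relation (these differ in a noncommutative ring), and so does passing to a
   principal submatrix.  Let V = (T^tr)^-1 and let A be the complement of B.
   Expanding quantum minors along the first column, and using that a quantum
   minor with two equal columns vanishes, gives
     V_AA(u) (T~(u))^tr = qdet T_BB(u-1) . 1.
   Hence T~ = (V_AA^-1)^tr qdet T_BB(u-1), where the first factor satisfies the
   RTT relation and commutes with the entries of T_BB; as qdet T_BB is central
   in the algebra generated by T_BB, also T~ satisfies the RTT relation.
   The case B = complement of {a} reads
     V_aa(u) qdet T(u) = qdet T_BB(u-1),
   which yields centrality of qdet T by induction on n, and, when applied to both
   T and T~, the product formula by induction on m. *)
Require Import Defs.
From mathcomp Require Import all_boot all_algebra all_fingroup.
From mathcomp Require Import boolp reals complex.
From HB Require Import structures.

Set Implicit Arguments.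
Unset Strict Implicit.
Unset Printing Implicit Defensive.

Import GRing.Theory.
Local Open Scope ring_scope.

(** * Series in u^-1 and their shifts *)

Lemma sum_antidiagonal (V : nmodType) (F : nat -> nat -> V) (N : nat) :
  \sum_(q < N) \sum_(r < q.+1) F r (q - r)%N =
  \sum_(r < N) \sum_(s < N - r) F r s.
Proof.
elim: N => [|N IHN]; first by rewrite !big_ord0.
rewrite big_ord_recr /= IHN.
under [RHS]eq_bigr => r _ do
  rewrite subSn -1?ltnS ?ltn_ord // big_ord_recr /=.
rewrite big_split /=; congr (_ + _).
by rewrite big_ord_recr /= subnn big_ord0 addr0.
Qed.

Lemma sum_ord_widen (V : nmodType) (F : nat -> V) (m n : nat) :
  (m <= n)%N -> (forall i, (m <= i < n)%N -> F i = 0) ->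
  \sum_(i < n) F i = \sum_(i < m) F i.
Proof.
move=> lemn F0; rewrite [RHS](big_ord_widen n) //.
rewrite [LHS](bigID (fun i : 'I_n => i < m)%N) /=.
rewrite [X in _ + X]big1 ?addr0 // => i; rewrite -leqNgt => lemi.
by rewrite F0 ?lemi ?ltn_ord.
Qed.

Section Series.
Variable A : nzRingType.
Implicit Types (f g h : pseries A) (z : A).

Lemma pcoefD f g r : (f + g) r = f r + g r. Proof. by []. Qed.
Lemma pcoefN f r : (- f) r = - f r. Proof. by []. Qed.
Lemma pcoef0 r : (0 : pseries A) r = 0. Proof. by []. Qed.
Lemma pcoef1 r : (1 : pseries A) r = (r == 0)%N%:R. Proof. by []. Qed.
Lemma pcoefM f g r : (f * g) r = \sum_(i < r.+1) f i * g (r - i)%N.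
Proof. by []. Qed.

Lemma pcoef_sum (I : Type) (s : seq I) (P : pred I) (F : I -> pseries A) r :
  (\sum_(i <- s | P i) F i) r = \sum_(i <- s | P i) F i r.
Proof. exact: (big_morph (fun f : pseries A => f r)). Qed.

Lemma pcoefM0 f g : (f * g) 0 = f 0 * g 0.
Proof. by rewrite pcoefM big_ord1. Qed.

Lemma pcoef_sign (n : nat) f r : ((-1) ^+ n * f) r = (-1) ^+ n * f r.
Proof. by rewrite -signr_odd -(signr_odd A) !mulr_sign; case: (odd n). Qed.

(** The coefficient of u^-r in f g is g_r plus terms in lower coefficients of g, so g can be
    recovered recursively. *)
Lemma pseries_lreg f : f 0 = 1 -> GRing.lreg f.
Proof.
move=> f0; apply: mulrI0_lreg => g fg0; apply: pseriesP => r.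
elim/ltn_ind: r => r IHr; have : (f * g) r = 0 by rewrite fg0.
rewrite pcoefM big_ord_recl f0 mul1r subn0 big1 ?addr0 // => i _.
by rewrite IHr ?mulr0 // ltn_subrL (leq_ltn_trans _ (ltn_ord i)).
Qed.

Definition psC z : pseries A := PSeries (fun r => if r is 0 then z else 0).

Lemma pcoefCM z f r : (psC z * f) r = z * f r.
Proof.
rewrite pcoefM big_ord_recl subn0 big1 ?addr0 // => i _.
by rewrite mul0r.
Qed.

Lemma pcoefMC z f r : (f * psC z) r = f r * z.
Proof.
rewrite pcoefM big_ord_recr /= subnn big1 ?add0r // => i _.
by move: (subn_gt0 i r); rewrite ltn_ord; case: (r - i)%N => //= k _; rewrite mulr0.
Qed.

Fact psC_zmod_morphism : zmod_morphism psC.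
Proof. by move=> x y; apply: pseriesP => -[|r] //=; rewrite subr0. Qed.
HB.instance Definition _ :=
  GRing.isZmodMorphism.Build A (pseries A) psC psC_zmod_morphism.
Fact psC_monoid_morphism : monoid_morphism psC.
Proof.
split=> [|x y]; first by apply: pseriesP => -[|r].
by apply: pseriesP => -[|r]; rewrite pcoefCM //= mulr0.
Qed.
HB.instance Definition _ :=
  GRing.isMonoidMorphism.Build A (pseries A) psC psC_monoid_morphism.

(** Turns commutation of z with every coefficient into commutation inside the ring of series, where
    closure under sums and products is available. *)
Lemma comm_psCP z f :
  GRing.comm (psC z) f <-> forall r, GRing.comm z (f r).
Proof.
split=> [zf r|zf]; first by rewrite /GRing.comm -pcoefCM zf pcoefMC.
by apply: pseriesP => r; rewrite pcoefCM pcoefMC zf.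
Qed.

Definition psX : pseries A := PSeries (fun r => (r == 1)%N%:R).

Lemma pcoefXM f r : (psX * f) r = if r is r'.+1 then f r' else 0.
Proof.
rewrite pcoefM; case: r => [|r]; first by rewrite big_ord1 mul0r.
rewrite big_ord_recl big_ord_recl mul0r add0r mul1r subn1 big1 ?addr0 // => i _.
by rewrite mul0r.
Qed.

Lemma comm_psX f : GRing.comm f psX.
Proof.
apply: pseriesP => r; rewrite pcoefXM pcoefM; case: r => [|r].
  by rewrite big_ord1 mulr0.
rewrite big_ord_recr big_ord_recr /= subnn mulr0 addr0 subSnn mulr1.
rewrite big1 ?add0r // => i _.
by rewrite /bump /= gtn_eqF ?mulr0 // ltn_subRL addn1 !ltnS.
Qed.

Lemma psX_lreg : GRing.lreg psX.
Proof.
apply: mulrI0_lreg => f Xf0; apply: pseriesP => r.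
by have := pcoefXM f r.+1; rewrite Xf0 /=.
Qed.

Definition psorder f k := forall r, (r < k)%N -> f r = 0.

Lemma psorderM f g k l : psorder f k -> psorder g l -> psorder (f * g) (k + l).
Proof.
move=> fk gl r lt_r; rewrite pcoefM big1 // => i _.
have [/fk->|leki] := ltnP i k; first by rewrite mul0r.
by rewrite gl ?mulr0 // ltn_subLR ?(leq_trans lt_r) ?leq_add2r // -ltnS.
Qed.

Lemma psorderX f k : f 0 = 0 -> psorder (f ^+ k) k.
Proof.
move=> f0; elim: k => [|k IHk]; first by move=> ?.
by rewrite exprS -add1n; apply: psorderM => // -[].
Qed.

End Series.

Section MapSeries.
Variables (A B : nzRingType) (phi : {rmorphism A -> B}).

Fact map_pseries_zmod_morphism : zmod_morphism (map_pseries phi).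
Proof. by move=> f g; apply: pseriesP => r /=; rewrite rmorphB. Qed.
HB.instance Definition _ := GRing.isZmodMorphism.Build _ _ (map_pseries phi)
  map_pseries_zmod_morphism.
Fact map_pseries_monoid_morphism : monoid_morphism (map_pseries phi).
Proof.
split=> [|f g]; apply: pseriesP => r /=; first by rewrite rmorph_nat.
by rewrite rmorph_sum; apply: eq_bigr => i _; rewrite rmorphM.
Qed.
HB.instance Definition _ := GRing.isMonoidMorphism.Build _ _ (map_pseries phi)
  map_pseries_monoid_morphism.
End MapSeries.

(** * The substitution of u - c for u *)

Section Shift.
Variables (K : comNzRingType).

Lemma inv_shift_order (c : K) k : psorder (inv_shift c ^+ k) k.
Proof. exact: psorderX. Qed.

(** This is (1 - c u^-1) (u - c)^-1 = u^-1 in recursive form; it determines the expansion because 1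
    - c u^-1 is regular. *)
Lemma inv_shiftE (c : K) : inv_shift c = psX K + psX K * (psC c * inv_shift c).
Proof.
apply: pseriesP => r; rewrite pcoefD pcoefXM; case: r => [|r]; first by rewrite addr0.
by rewrite pcoefCM; case: r => [|r] /=; rewrite ?mulr0 ?addr0 // add0r exprS.
Qed.

Section Algebra.
Variable A : algType K.
Implicit Types f g : pseries A.

Lemma shift_widen (c : K) f s M : (s < M)%N ->
  shift c f s = \sum_(r < M) (inv_shift c ^+ r) s *: f r.
Proof.
move=> ltsM; pose F r := (inv_shift c ^+ r) s *: f r.
apply: esym; apply: (@sum_ord_widen _ F) => // r /andP[lt_sr _].
by rewrite /F inv_shift_order ?scale0r.
Qed.

Fact shift_zmod_morphism c : zmod_morphism (@shift K A c).
Proof.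
move=> f g; apply: pseriesP => s /=; rewrite -sumrB.
by apply: eq_bigr => r _; rewrite scalerBr.
Qed.
HB.instance Definition _ c := GRing.isZmodMorphism.Build _ _ (@shift K A c)
  (shift_zmod_morphism c).

Fact shift_monoid_morphism c : monoid_morphism (@shift K A c).
Proof.
split=> [|f g]; apply: pseriesP => N.
  rewrite (shift_widen _ _ (ltnSn N)) big_ord_recl expr0 !pcoef1 big1 ?addr0 => [|i _].
    by case: N => [|N]; rewrite ?scale1r ?scale0r.
  by rewrite scaler0.
set y := inv_shift c; pose G r s := (y ^+ (r + s)) N *: (f r * g s).
transitivity (\sum_(q < N.+1) \sum_(r < q.+1) G r (q - r)%N).
  apply: eq_bigr => q _; rewrite pcoefM scaler_sumr; apply: eq_bigr => r _.
  by rewrite /G subnKC // -ltnS.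
rewrite sum_antidiagonal.
(* [G r s] vanishes for r + s > N, so the triangle of indices completes to a square, on which (u -
   c)^-(r+s) splits as a product. *)
transitivity (\sum_(r < N.+1) \sum_(s < N.+1) G r s).
  apply: eq_bigr => r _; apply: esym; apply: (@sum_ord_widen _ (G r)) => [|s].
    exact: leq_subr.
  move=> /andP[lt_s _]; rewrite /G inv_shift_order ?scale0r //.
  by rewrite -leq_subLR.
rewrite pcoefM.
under [RHS]eq_bigr => i _ do
  rewrite (shift_widen _ _ (ltn_ord i)) (@shift_widen _ _ (N - i)%N N.+1)
    ?ltnS ?leq_subr // big_distrlr /=.
rewrite [RHS]exchange_big /=; apply: eq_bigr => r _.
rewrite [RHS]exchange_big /=; apply: eq_bigr => s _.
rewrite /G exprD pcoefM scaler_suml; apply: eq_bigr => i _.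
by rewrite -scalerAl -scalerAr scalerA.
Qed.
HB.instance Definition _ c := GRing.isMonoidMorphism.Build _ _ (@shift K A c)
  (shift_monoid_morphism c).

Lemma shift_coef0 (c : K) f : shift c f 0 = f 0.
Proof. by rewrite /= big_ord1 expr0 scale1r. Qed.

End Algebra.

(** Both sides solve (1 - (c + d) u^-1) X = u^-1, and the factor on the left is regular. [K^o] is K
    as an algebra over itself, so that [shift] applies to scalar series. *)
Lemma shift_inv_shift (c d : K) :
  shift (A := K^o) c (inv_shift d) = inv_shift (c + d).
Proof.
pose sh (f : pseries K) : pseries K := shift (A := K^o) c f.
have shD f g : sh (f + g) = sh f + sh g by exact: (rmorphD (shift (A := K^o) c)).
have shM f g : sh (f * g) = sh f * sh g by exact: (rmorphM (shift (A := K^o) c)).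
have shiftX : sh (psX K) = inv_shift c.
  apply: pseriesP => -[|r]; first by rewrite /sh shift_coef0.
  rewrite /sh (shift_widen _ _ (ltnSn _)) !big_ord_recl scaler0 add0r big1 => [|i _].
    by rewrite addr0 expr1; exact: mulr1.
  by rewrite scaler0.
have shiftC z : sh (psC z) = psC z.
  apply: pseriesP => r.
  rewrite /sh (shift_widen _ _ (ltnSn _)) big_ord_recl expr0 pcoef1 big1 => [|i _].
    rewrite addr0; by case: r => [|r]; [exact: mul1r | exact: mul0r].
  by rewrite scaler0.
pose Y := sh (inv_shift d).
have YE : Y = inv_shift c + inv_shift c * (psC d * Y).
  by rewrite {1}/Y inv_shiftE shD !shM shiftX shiftC.
have Xreg (a : K) : GRing.lreg (1 - psX K * psC a).
  by apply: pseries_lreg; rewrite pcoefD pcoefN pcoefXM subr0.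
have invE (a : K) : (1 - psX K * psC a) * inv_shift a = psX K.
  rewrite mulrBl mul1r {1}inv_shiftE -!mulrA; exact: addrK.
apply: (Xreg (c + d)); rewrite -/(sh _) -/Y invE.
rewrite raddfD mulrDr opprD addrA mulrBl {1}YE mulrDr (mulrA _ (inv_shift c)) !invE.
rewrite -!mulrA; exact: addrK.
Qed.

(** Exchanging the sums leaves [shift c (inv_shift d ^+ r)], which is [inv_shift (c + d) ^+ r]
    because [shift] is multiplicative. *)
Lemma shift_shift (A : algType K) (c d : K) (f : pseries A) :
  shift c (shift d f) = shift (c + d) f.
Proof.
apply: pseriesP => N.
transitivity (\sum_(s < N.+1) \sum_(r < N.+1)
    ((inv_shift c ^+ s) N * (inv_shift d ^+ r) s) *: f r).
  apply: eq_bigr => s _; rewrite (shift_widen _ _ (ltn_ord s)) scaler_sumr.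
  by apply: eq_bigr => r _; rewrite scalerA.
rewrite exchange_big; apply: eq_bigr => r _ /=; rewrite -scaler_suml.
by rewrite -shift_inv_shift -(rmorphXn (shift (A := K^o) c)).
Qed.

Lemma shift0 (A : algType K) (f : pseries A) : shift 0 f = f.
Proof.
have inv0 : inv_shift (0 : K) = psX K.
  by rewrite inv_shiftE raddf0 mul0r mulr0 addr0.
have coefX k r : (psX K ^+ k) r = (r == k)%:R.
  elim: k r => [|k IHk] r; first by rewrite pcoef1.
  by rewrite exprS pcoefXM; case: r => [|r]; rewrite // IHk eqSS.
apply: pseriesP => s /=; rewrite big_ord_recr /= inv0 coefX eqxx scale1r big1 ?add0r //.
by move=> i _; rewrite coefX gtn_eqF ?ltn_ord ?scale0r.
Qed.

End Shift.

(** * RTT pairs of matrices and series in two variables *)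

Lemma mxBE (V : zmodType) m n (M N : 'M[V]_(m, n)) i j :
  (M - N) i j = M i j - N i j.
Proof. by rewrite !mxE. Qed.

Section RTT.
Variable R : nzRingType.

Definition central (a : R) := forall x, GRing.comm a x.

Lemma mulmx_scalarE m n (M : 'M[R]_(m, n)) (x : R) i j :
  (M *m x%:M) i j = M i j * x.
Proof.
rewrite mxE (bigD1 j) //= mxE eqxx mulr1n big1 ?addr0 // => k /negPf nkj.
by rewrite mxE nkj mulr0n mulr0.
Qed.

Lemma scalar_mulmxE m n (M : 'M[R]_(m, n)) (x : R) i j :
  (x%:M *m M) i j = x * M i j.
Proof. by rewrite mul_scalar_mx mxE. Qed.

Lemma col_row_mulE m n p q (M : 'M[R]_(m, n)) (N : 'M[R]_(p, q)) i j k l :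
  (col j M *m row i N) k l = M k j * N i l.
Proof. by rewrite mxE big_ord1 !mxE. Qed.

Lemma col_mulmx m n p (M : 'M[R]_(m, n)) (N : 'M[R]_(n, p)) j :
  col j (M *m N) = M *m col j N.
Proof. by rewrite !colE mulmxA. Qed.

(** Multiplication by P' on both sides: P' (x P - P x) P' = P' x - x P', where x stands for the
    scalar matrix [x%:M]. *)
Lemma inverse_comm_rel (a b x : R) n (P P' N : 'M[R]_n) :
  central a -> central b -> P' *m P = 1%:M -> P *m P' = 1%:M ->
  (forall k l, a * (x * P k l - P k l * x) = b * N k l) ->
  forall k l, a * (P' k l * x - x * P' k l) = b * (P' *m N *m P') k l.
Proof.
move=> ca cb P'P PP' xP k l.
have scC c (M : 'M[R]_n) : central c -> c%:M *m M = M *m c%:M.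
  by move=> cc; apply/matrixP => i j; rewrite mulmx_scalarE scalar_mulmxE cc.
have xPM : a%:M *m (x%:M *m P - P *m x%:M) = b%:M *m N.
  apply/matrixP => i j; rewrite !scalar_mulmxE -xP.
  by rewrite mxBE scalar_mulmxE mulmx_scalarE.
have : P' *m (a%:M *m (x%:M *m P - P *m x%:M)) *m P' = P' *m (b%:M *m N) *m P'.
  by rewrite xPM.
rewrite (mulmxA P' a%:M) (mulmxA P' b%:M) -(scC a) // -(scC b) //.
rewrite -!mulmxA => /matrixP/(_ k l).
rewrite !scalar_mulmxE mulmxBl mulmxBr -!mulmxA PP' mulmx1 (mulmxA P' P) P'P mul1mx.
by rewrite mxBE mulmx_scalarE scalar_mulmxE => ->.
Qed.

(* With a = v^-1 - u^-1 and b = u^-1 v^-1, this is the Yangian relation for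
   P = T(u) and Q = T(v). *)
Definition rtt (a b : R) n (P Q : 'M[R]_n) := forall i j k l,
  a * (P i j * Q k l - Q k l * P i j) = b * (P k j * Q i l - Q k j * P i l).

(** Transposition interchanges the two arguments, and so does inversion in [rtt_inv]; the composite
    of both restores their order. *)
Lemma rtt_tr (a b : R) n (P Q : 'M[R]_n) : rtt a b P Q -> rtt a b Q^T P^T.
Proof.
by move=> PQ i j k l; rewrite !mxE -opprB mulrN PQ -mulrN opprB.
Qed.

Section Inverse.
Variables (a b : R) (n : nat) (P Q P' Q' : 'M[R]_n).
Hypotheses (ca : central a) (cb : central b) (PQ : rtt a b P Q).
Hypotheses (P'P : P' *m P = 1%:M) (PP' : P *m P' = 1%:M).
Hypotheses (Q'Q : Q' *m Q = 1%:M) (QQ' : Q *m Q' = 1%:M).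

(** For fixed i and j, the commutators of [P i j] with the entries of Q form a difference of
    products of a column and a row. Conjugating by Q' turns row i of Q and column j of Q into those
    of the identity. *)
Lemma rtt_cross i j k l :
  a * (Q' k l * P i j - P i j * Q' k l) =
  b * ((Q' *m P) k j *+ (i == l) - (P *m Q') i l *+ (k == j)).
Proof.
rewrite (@inverse_comm_rel _ b _ _ Q _ (col j P *m row i Q - col j Q *m row i P)) //.
  rewrite mulmxBr mulmxBl 2!mulmxA -!col_mulmx -2!mulmxA -!row_mul QQ' Q'Q.
  rewrite mxBE !col_row_mulE !mxE.
  by rewrite mulr_natr mulr_natl.
by move=> c d; rewrite PQ mxBE !col_row_mulE.
Qed.

(** A second conjugation, by P', applied to the relation [rtt_cross] between P and Q'. *)
Lemma rtt_inv : rtt a b Q' P'.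
Proof.
move=> k l c d; rewrite -opprB mulrN.
rewrite (@inverse_comm_rel _ b _ _ P _
  (col l 1%:M *m row k (Q' *m P) - col l (P *m Q') *m row k 1%:M)) //.
  rewrite mulmxBr mulmxBl 2!mulmxA -!col_mulmx -2!mulmxA -!row_mul mulmx1 mul1mx.
  rewrite mulmxA P'P mul1mx -mulmxA PP' mulmx1.
  by rewrite mxBE !col_row_mulE -mulrN opprB.
move=> i j; rewrite rtt_cross mxBE !col_row_mulE.
by rewrite [1%:M i l]mxE [1%:M k j]mxE mulr_natr mulr_natl.
Qed.

End Inverse.

(** Each product in the relation acquires the same right factor p q. *)
Lemma rtt_scale (a b p q : R) n (P Q : 'M[R]_n) :
  (forall i j, GRing.comm p (Q i j)) -> (forall i j, GRing.comm q (P i j)) ->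
  (forall i j, GRing.comm p (P i j)) -> (forall i j, GRing.comm q (Q i j)) ->
  GRing.comm p q ->
  rtt a b P Q ->
  rtt a b (P *m p%:M) (Q *m q%:M).
Proof.
move=> pQ qP pP qQ pq PQ i j k l; rewrite !mulmx_scalarE.
have E1 i' j' k' l' : P i' j' * p * (Q k' l' * q) = P i' j' * Q k' l' * (p * q).
  by rewrite -!mulrA (mulrA p) pQ !mulrA.
have E2 i' j' k' l' : Q i' j' * q * (P k' l' * p) = Q i' j' * P k' l' * (p * q).
  by rewrite -!mulrA (mulrA q) qP !mulrA -(mulrA _ q) -pq mulrA.
by rewrite !E1 !E2 -!mulrBl !mulrA PQ.
Qed.

End RTT.

(** * Inverses of matrices with constant term 1 *)

Section MatrixSeries.
Variable A : nzRingType.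

Definition unital n (t : 'M[pseries A]_n) := forall i j, t i j 0 = (i == j)%:R.

(** Neumann series: N = 1 - t has no constant term, so the sum of the powers of N converges
    coefficientwise to a two-sided inverse. *)
Lemma unital_inv n (t : 'M[pseries A]_n) : unital t ->
  exists V, V *m t = 1%:M /\ t *m V = 1%:M.
Proof.
move=> t0; pose N : 'M[pseries A]_n := 1 - t.
have ordN k i j : psorder ((N ^+ k) i j) k.
  elim: k i j => [|k IHk] i j; first by move=> ?.
  rewrite exprS mxE => r lt_r; rewrite pcoef_sum big1 // => l _.
  have N1 : psorder (N i l) 1.
    by case=> // _; rewrite mxBE pcoefD pcoefN t0 mxE; case: eqP; rewrite subrr.
  exact: (psorderM N1 (IHk l j)).
pose S M : 'M[pseries A]_n := \sum_(k < M) N ^+ k.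
have SE M M' i j r : (r < M)%N -> (r < M')%N -> S M i j r = S M' i j r.
  wlog leM : M M' / (M <= M')%N => [IH ltM ltM'|ltM _].
    by have /orP[leM|leM] := leq_total M M'; [|apply/esym]; apply: IH.
  rewrite /S !summxE !pcoef_sum; apply: esym.
  apply: (@sum_ord_widen _ (fun k => (N ^+ k) i j r)) => // k /andP[leMk _].
  by apply: ordN; apply: leq_trans leMk.
have [tS St] :
    (forall M, t *m S M = 1 - N ^+ M) /\ (forall M, S M *m t = 1 - N ^+ M).
  have tE : t = 1 - N by rewrite /N subKr.
  have cNS M : GRing.comm N (S M).
    by apply: commr_sum => k _; exact: commrX.
  have NS M : t *m S M = 1 - N ^+ M.
    by rewrite -[1 - N ^+ M]opprB subrX1 -mulNr opprB -tE.
  split=> M //; rewrite -NS tE; apply: commrB; last exact: commr_sym.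
  exact: commr1.
(* N^k starts at u^-k, so the powers up to N^r already determine the coefficient of u^-r. *)
pose V := \matrix_(i, j) PSeries (fun r => S r.+1 i j r).
have SV i j r M : (r < M)%N -> V i j r = S M i j r.
  by move=> ltrM; rewrite mxE; apply: SE.
have one_sub i j r : (1 - N ^+ r.+1) i j r = (1%:M : 'M[pseries A]_n) i j r.
  by rewrite mxBE pcoefD pcoefN ordN // oppr0 addr0.
exists V; split; apply/matrixP => i j; apply: pseriesP => r; rewrite -one_sub.
  rewrite -St !mxE !pcoef_sum; apply: eq_bigr => l _; rewrite !pcoefM.
  by apply: eq_bigr => k _; rewrite (SV _ _ _ r.+1).
rewrite -tS !mxE !pcoef_sum; apply: eq_bigr => l _; rewrite !pcoefM.
by apply: eq_bigr => k _; rewrite (SV _ _ _ r.+1) // ltnS leq_subr.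
Qed.

Lemma unital_tr n (t : 'M[pseries A]_n) : unital t -> unital t^T.
Proof. by move=> t0 i j; rewrite mxE t0 eq_sym. Qed.

Lemma unital_linv n (t V : 'M[pseries A]_n) :
  unital t -> V *m t = 1%:M -> unital V.
Proof.
move=> t0 Vt i j; have : (V *m t) i j 0 = (1%:M : 'M[pseries A]_n) i j 0.
  by rewrite Vt.
rewrite mxE pcoef_sum (bigD1 j) // pcoefM0 t0 eqxx mulr1 big1 => [|k /negPf nkj].
  by rewrite /= addr0 mxE => ->; case: eqP.
by rewrite pcoefM0 t0 nkj mulr0.
Qed.

End MatrixSeries.

(** * Series in two independent variables *)

Section TwoVariables.
Variable A : nzRingType.
Implicit Types f g : pseries A.

(* The ring pseries (pseries A) is A[[u^-1, v^-1]]: the outer variable is v^-1. *)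
Definition in_u : pseries A -> pseries (pseries A) := @psC (pseries A).
HB.instance Definition _ := GRing.RMorphism.on in_u.
Definition in_v : pseries A -> pseries (pseries A) := map_pseries (@psC A).
HB.instance Definition _ := GRing.RMorphism.copy in_v (map_pseries (@psC A)).
Definition uinv : pseries (pseries A) := psC (psX A).
Definition vinv : pseries (pseries A) := psX (pseries A).

Lemma in_uvE f g r s : (in_u f * in_v g) s r = f r * g s.
Proof. by rewrite pcoefCM pcoefMC. Qed.

Lemma in_vuE f g r s : (in_v g * in_u f) s r = g s * f r.
Proof. by rewrite pcoefMC pcoefCM. Qed.

Lemma central_uinv : central uinv.
Proof. by move=> F; apply/comm_psCP => s; apply: commr_sym; exact: comm_psX. Qed.

Lemma central_vinv : central vinv.
Proof. by move=> F; apply: commr_sym; exact: comm_psX. Qed.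

Lemma central_vinvBuinv : central (vinv - uinv).
Proof.
move=> F; apply: commr_sym.
by apply: commrB; apply: commr_sym; [exact: central_vinv|exact: central_uinv].
Qed.

Lemma central_uinvMvinv : central (uinv * vinv).
Proof.
move=> F; apply: commr_sym.
by apply: commrM; apply: commr_sym; [exact: central_uinv|exact: central_vinv].
Qed.

(** If the product with F vanishes, comparing coefficients of v^-s gives u^-1 F_0 = 0 and u^-1
    F_(s+1) = F_s; induction on s applies since u^-1 is regular. *)
Lemma vinvBuinv_lreg : GRing.lreg (vinv - uinv).
Proof.
apply: mulrI0_lreg => F yxF0; apply: pseriesP => s.
have E s' : (if s' is s''.+1 then F s'' else 0) = psX A * F s'.
  apply/eqP; rewrite -subr_eq0; apply/eqP.
  by rewrite -[RHS](pcoef0 _ s') -yxF0 mulrBl pcoefD pcoefN pcoefXM pcoefCM.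
elim: s => [|s IHs]; apply: (@psX_lreg A); rewrite -E ?mulr0 //.
Qed.

(** Means [f(u), g(v)] = 0 for independent u and v, which is stronger than commutation in the ring
    of series. *)
Definition pscomm f g := forall r s, GRing.comm (f r) (g s).

Lemma pscommP f g : pscomm f g <-> GRing.comm (in_u f) (in_v g).
Proof.
split=> [fg|fg r s]; last by rewrite /GRing.comm -in_uvE fg in_vuE.
by apply: pseriesP => s; apply: pseriesP => r; rewrite in_uvE in_vuE fg.
Qed.

End TwoVariables.

(** * The RTT relation and its specialization at v = u - 1 *)

(** Exactly the hypotheses of [yangian_lift]: such matrices are the images of the generator matrix
    under homomorphisms from the Yangian. *)
Definition rtt_series (A : nzRingType) n (t : 'M[pseries A]_n) :=
  unital t /\ forall i j k l r s, yangian_rel t i j k l r s = 0.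

Lemma map_mx_inverse (A B : nzRingType) (phi : {rmorphism A -> B}) n (P P' : 'M[A]_n) :
  P' *m P = 1%:M -> map_mx phi P' *m map_mx phi P = 1%:M.
Proof. by rewrite -map_mxM => ->; rewrite map_mx1. Qed.

Section RTTSeries.
Variable A : nzRingType.

(** The defining relation is multiplied by u^-1 v^-1, which turns u - v into v^-1 - u^-1. The extra
    boundary coefficients vanish because the constant terms of t commute with everything. *)
Lemma rtt_seriesP n (t : 'M[pseries A]_n) : unital t ->
  (forall i j k l r s, yangian_rel t i j k l r s = 0) <->
  rtt (vinv A - uinv A) (uinv A * vinv A)
    (map_mx (@in_u A) t) (map_mx (@in_v A) t).
Proof.
move=> t0.
have comm0 i j x : GRing.comm x (t i j 0) by rewrite t0; exact: commr_nat.
pose C i j k l r s := t i j r * t k l s - t k l s * t i j r.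
pose D i j k l r s := t k j r * t i l s - t k j s * t i l r.
have relE i j k l r s :
    yangian_rel t i j k l r s = C i j k l r.+1 s - C i j k l r s.+1 - D i j k l r s.
  by [].
have C0l i j k l s : C i j k l 0 s = 0 by rewrite /C comm0 subrr.
have C0r i j k l r : C i j k l r 0 = 0 by rewrite /C comm0 subrr.
pose P := map_mx (@in_u A) t; pose Q := map_mx (@in_v A) t.
have CE i j k l r s : (P i j * Q k l - Q k l * P i j) s r = C i j k l r s.
  by rewrite !mxE !pcoefD !pcoefN in_uvE in_vuE.
have DE i j k l r s : (P k j * Q i l - Q k j * P i l) s r = D i j k l r s.
  by rewrite !mxE !pcoefD !pcoefN in_uvE in_vuE.
have lhsE (F : pseries (pseries A)) r s : ((vinv A - uinv A) * F) s r =
    (if s is s'.+1 then F s' r else 0) - (if r is r'.+1 then F s r' else 0).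
  rewrite mulrBl !pcoefD !pcoefN pcoefXM pcoefCM pcoefXM.
  by case: s.
have rhsE (F : pseries (pseries A)) r s : ((uinv A * vinv A) * F) s r =
    (if r is r'.+1 then if s is s'.+1 then F s' r' else 0 else 0).
  by rewrite -mulrA pcoefCM pcoefXM; case: r => // r; rewrite pcoefXM; case: s.
rewrite -/P -/Q; split=> [rel i j k l|R i j k l r s].
  move: (CE i j k l) (DE i j k l).
  move: (_ - _) (_ - Q k j * _) => F G FE GE.
  apply: pseriesP => s; apply: pseriesP => r; rewrite lhsE rhsE.
  case: r s => [|r] [|s]; rewrite ?FE ?GE ?C0l ?C0r ?subrr //.
  by apply/eqP; rewrite -subr_eq0 -relE rel.
move: (CE i j k l) (DE i j k l) (R i j k l).
move: (_ - _) (_ - Q k j * _) => F G FE GE.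
move=> /(congr1 (fun H : pseries (pseries A) => H s.+1 r.+1)).
by rewrite lhsE rhsE !FE GE relE => ->; rewrite subrr.
Qed.

Section Inverse.
Variables (n : nat) (t V : 'M[pseries A]_n).
Hypothesis rtt_t : rtt_series t.

Lemma rtt_series_inv_tr : V *m t = 1%:M -> t *m V = 1%:M -> rtt_series V^T.
Proof.
have [t0 /(rtt_seriesP t0) tt] := rtt_t.
move=> Vt tV; have V0 : unital V^T by apply/unital_tr/(unital_linv t0 Vt).
split=> //; apply/(rtt_seriesP V0); rewrite -!map_trmx; apply: rtt_tr.
by apply: (rtt_inv (@central_vinvBuinv A) (@central_uinvMvinv A) tt);
  apply: map_mx_inverse.
Qed.

Lemma rtt_series_tr_inv : V *m t^T = 1%:M -> t^T *m V = 1%:M -> rtt_series V.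
Proof.
have [t0 /(rtt_seriesP t0) /rtt_tr tt] := rtt_t.
move=> Vt tV; have V0 : unital V := unital_linv (unital_tr t0) Vt.
split=> //; apply/(rtt_seriesP V0); rewrite !map_trmx in tt.
by apply: (rtt_inv (@central_vinvBuinv A) (@central_uinvMvinv A) tt);
  apply: map_mx_inverse.
Qed.

(** Both Kronecker deltas in [rtt_cross] vanish, and the factor v^-1 - u^-1 is then cancelled. *)
Lemma tr_inv_pscomm p q k l : V *m t^T = 1%:M -> t^T *m V = 1%:M ->
  p != k -> q != l -> pscomm (V k l) (t p q).
Proof.
have [t0 /(rtt_seriesP t0) /rtt_tr tt] := rtt_t.
move=> Vt tV; rewrite eq_sym => /negPf npk /negPf nql.
apply/pscommP; rewrite !map_trmx in tt.
have tV' := map_mx_inverse (@in_u A) tV.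
have Vt' := map_mx_inverse (@in_u A) Vt.
have := rtt_cross (@central_vinvBuinv A) (@central_uinvMvinv A) tt Vt' tV' q p k l.
rewrite npk nql !mulr0n subr0 mulr0 !mxE => /eqP.
rewrite -(mulr0 (vinv A - uinv A)) => /eqP/(@vinvBuinv_lreg A)/eqP.
by rewrite subr_eq0 => /eqP.
Qed.

(** The relation at r = 0, where [t i j 0] is a Kronecker delta: the coefficients of u^-1 act on
    T(v) by the commutators of gl(n). *)
Lemma rtt_gen1_comm i j k l s :
  t i j 1 * t k l s - t k l s * t i j 1 =
  t i l s *+ (k == j) - t k j s *+ (i == l).
Proof.
have [t0 /(_ i j k l 0 s)] := rtt_t; rewrite /yangian_rel !t0.
rewrite (commr_nat (t k l s.+1)) subrr subr0 => /eqP; rewrite subr_eq0 => /eqP ->.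
by rewrite mulr_natl mulr_natr.
Qed.

(** With all indices equal, the relation reads [t_(r+1), t_s] = [t_r, t_(s+1)] + [t_r, t_s], which
    reduces r. *)
Lemma rtt_series_diag_comm i r s : GRing.comm (t i i r) (t i i s).
Proof.
have [t0 rel] := rtt_t; elim: r s => [|r IHr] s.
  by rewrite t0; apply: commr_sym; exact: commr_nat.
apply/eqP; rewrite -subr_eq0; have := rel i i i i r s; rewrite /yangian_rel.
by rewrite (IHr s.+1) (IHr s) !subrr !subr0 => ->.
Qed.

End Inverse.

Lemma rtt_series_sub m n (t : 'M[pseries A]_n) (f : 'I_m -> 'I_n) :
  injective f -> rtt_series t -> rtt_series (mxsub f f t).
Proof.
move=> inj_f [t0 rel]; split=> [i j|i j k l r s].
  by rewrite mxE t0 (inj_eq inj_f).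
by rewrite -[RHS](rel (f i) (f j) (f k) (f l) r s) /yangian_rel !mxE.
Qed.

End RTTSeries.

(** * Substituting v = u - 1 in two-variable series *)

Section Specialization.
Variables (K : comNzRingType) (A : algType K).
Let W s M : K := (inv_shift 1 ^+ s) M.

(** Coefficient form of v^-1 = u^-1 + u^-1 v^-1 for v = u - 1, multiplied by v^-s. *)
Let WS s M : W s.+1 M.+1 = W s M + W s.+1 M.
Proof.
rewrite /W exprS {1}inv_shiftE rmorph1 mul1r mulrDl pcoefD -mulrA -exprS.
by rewrite !pcoefXM.
Qed.

Let W0 s M : (M < s)%N -> W s M = 0.
Proof. exact: inv_shift_order. Qed.

(** The coefficient of u^-N in u^-r (u - 1)^-s. *)
Let w N r s : K := if (r <= N)%N then W s (N - r) else 0.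

(* The series F(u, u-1), for the coefficients c r s of u^-r v^-s in F(u, v). *)
Let ev (c : nat -> nat -> A) : pseries A := PSeries (fun N =>
  \sum_(r < N.+1) \sum_(s < N.+1) w N r s *: c r s).

Let ev_mul (f g : pseries A) : ev (fun r s => f r * g s) = f * shift 1 g.
Proof.
apply: pseriesP => N; apply: eq_bigr => r _.
rewrite (@shift_widen _ _ _ _ _ N.+1) ?ltnS ?leq_subr // mulr_sumr.
by apply: eq_bigr => s _; rewrite /w -ltnS ltn_ord scalerAr.
Qed.

Let ev_mulr (f g : pseries A) : ev (fun r s => g s * f r) = shift 1 g * f.
Proof.
apply: pseriesP => N; rewrite pcoefM [RHS](reindex_inj rev_ord_inj).
apply: eq_bigr => r _; have -> : rev_ord r = (N - r)%N :> nat by rewrite /= subSS.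
have -> : (N - (N - r) = r)%N by rewrite subKn // -ltnS.
rewrite (@shift_widen _ _ _ _ _ N.+1) ?ltnS ?leq_subr // mulr_suml.
by apply: eq_bigr => s _; rewrite /w -ltnS ltn_ord scalerAl.
Qed.

Let evB c d : ev (fun r s => c r s - d r s) = ev c - ev d.
Proof.
apply: pseriesP => N; rewrite pcoefD pcoefN /= -sumrB.
by apply: eq_bigr => r _; rewrite -sumrB; apply: eq_bigr => s _; rewrite scalerBr.
Qed.

(* (v^-1 - u^-1) C = u^-1 v^-1 D becomes C = D at v = u - 1, where
   v^-1 - u^-1 = u^-1 v^-1. *)
Let ev_eq c d : (forall r, c r 0 = 0) -> (forall s, c 0 s = 0) ->
  (forall r s, c r.+1 s - c r s.+1 = d r s) -> ev c = ev d.
Proof.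
move=> c0 c0' cd; apply: pseriesP => N /=.
under [RHS]eq_bigr => r _ do under eq_bigr => s _ do rewrite -cd scalerBr.
under [RHS]eq_bigr => r _ do rewrite sumrB.
rewrite sumrB.
(* The two shifted sums lose their boundary terms, where either c or the weight vanishes. The
   remaining weights are then compared by [WS]. *)
have -> : \sum_(r < N.+1) \sum_(s < N.+1) w N r s *: c r.+1 s =
    \sum_(r < N) \sum_(s < N) w N r s.+1 *: c r.+1 s.+1.
  rewrite big_ord_recr /= [X in _ + X]big1 => [|s _].
    rewrite addr0; apply: eq_bigr => r _.
    by rewrite big_ord_recl c0 scaler0 add0r.
  rewrite /w leqnn subnn; case: s => -[|s] /= lts; first by rewrite c0 scaler0.
  by rewrite W0 ?scale0r.
have -> : \sum_(r < N.+1) \sum_(s < N.+1) w N r s *: c r s.+1 =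
    \sum_(r < N) \sum_(s < N) w N r.+1 s *: c r.+1 s.+1.
  rewrite big_ord_recl /= [X in X + _]big1 => [|s _]; last by rewrite c0' scaler0.
  rewrite add0r; apply: eq_bigr => r _.
  rewrite big_ord_recr /= /w ltn_ord W0 ?scale0r ?addr0 //.
  by rewrite ltn_subrL (leq_ltn_trans _ (ltn_ord r)).
rewrite big_ord_recl [X in X + _]big1 => [|s _]; last by rewrite c0' scaler0.
rewrite add0r -sumrB; apply: eq_bigr => r _.
rewrite big_ord_recl c0 scaler0 add0r -sumrB; apply: eq_bigr => s _.
rewrite -scalerBl; congr (_ *: _); rewrite /w ltn_ord (ltnW (ltn_ord r)).
rewrite /=; have -> : (N - r = (N - r.+1).+1)%N by rewrite subnSK.
by rewrite WS [X in X - _]addrC addrK.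
Qed.

Variables (n : nat) (t : 'M[pseries A]_n).
Hypothesis rtt_t : rtt_series t.

Lemma rtt_shift1 i j k l :
  t i j * shift 1 (t k l) - shift 1 (t k l) * t i j =
  t k j * shift 1 (t i l) - shift 1 (t k j) * t i l.
Proof.
have [t0 rel] := rtt_t.
have comm0 i' j' x : GRing.comm x (t i' j' 0) by rewrite t0; exact: commr_nat.
rewrite -!ev_mul -!ev_mulr -!evB; apply: ev_eq => [r|s|r s].
- by rewrite comm0 subrr.
- by rewrite comm0 subrr.
- by apply/eqP; rewrite -subr_eq0; apply/eqP/(rel i j k l r s).
Qed.

(** At l = j the subtracted terms on the two sides of [rtt_shift1] coincide. *)
Lemma rtt_shift1_col i j k : t i j * shift 1 (t k j) = t k j * shift 1 (t i j).
Proof.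
have /eqP := rtt_shift1 i j k j.
by rewrite (inj_eq (addIr _)) => /eqP.
Qed.

(** Adding the instances for (j, l) and (l, j) cancels all products with the shifted factor on the
    left. The result says that a 2 x 2 quantum minor changes sign when its columns are exchanged. *)
Lemma rtt_shift1_antisym i j k l :
  t i j * shift 1 (t k l) + t i l * shift 1 (t k j) =
  t k j * shift 1 (t i l) + t k l * shift 1 (t i j).
Proof.
have jl := rtt_shift1 i j k l; have lj := rtt_shift1 i l k j.
apply: (addIr (- (shift 1 (t k l) * t i j) - shift 1 (t k j) * t i l)).
by rewrite addrACA jl lj addrACA (addrC (- _) (- _)).
Qed.

End Specialization.

(** * Quantum determinants and quantum minors *)

(** The terms of s and [tperm i j * s] cancel in pairs, which avoids a division by 2. *)
Lemma alternating_sum0 (V : pzRingType) n (i j : 'I_n) (F : 'S_n -> V) :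
  i != j -> (forall s, F (tperm i j * s)%g = F s) ->
  \sum_(s : 'S_n) (-1) ^+ s * F s = 0.
Proof.
move=> neq_ij Ft; rewrite (bigID (fun s : 'S_n => odd_perm s)) /=.
rewrite [X in X + _](reindex_inj (mulgI (tperm i j))) /=.
have odd_t s : (tperm i j * s)%g = ~~ s :> bool.
  by rewrite odd_permM odd_tperm neq_ij.
under eq_bigl => s do rewrite odd_t.
rewrite -big_split big1 // => s /negPf even_s.
by rewrite odd_t even_s Ft /= mulN1r mul1r addNr.
Qed.

Lemma prod_adjacent (R : pzRingType) n (g : 'I_n.+1 -> R) k : (k.+1 < n.+1)%N ->
  \prod_(i < n.+1) g i = \prod_(0 <= i < k) g (inord i) *
    (g (inord k) * g (inord k.+1)) * \prod_(k.+2 <= i < n.+1) g (inord i).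
Proof.
move=> ltk; transitivity (\prod_(i < n.+1) g (inord i)).
  by apply: eq_bigr => i _; rewrite inord_val.
rewrite -(big_mkord xpredT (fun i => g (inord i))).
rewrite (@big_cat_nat _ _ _ k) //=; last exact: ltnW (ltnW ltk).
by rewrite (big_ltn (ltnW ltk)) (big_ltn ltk) !mulrA.
Qed.

(** The factors do not commute, so a quadratic identity can be inserted only at neighbouring
    positions. Two products on each side match the shape of [rtt_shift1_antisym]. *)
Lemma prod_adjacent_congr (R : pzRingType) n (g1 g2 g3 g4 : 'I_n -> R) (k k' : 'I_n) :
  k' = k.+1 :> nat ->
  (forall i, i != k -> i != k' -> [/\ g2 i = g1 i, g3 i = g1 i & g4 i = g1 i]) ->
  g1 k * g1 k' + g2 k * g2 k' = g3 k * g3 k' + g4 k * g4 k' ->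
  \prod_i g1 i + \prod_i g2 i = \prod_i g3 i + \prod_i g4 i.
Proof.
case: n g1 g2 g3 g4 k k' => [|n] g1 g2 g3 g4 k k'; first by case: k.
move=> k'E gE g12; have ltk : (k.+1 < n.+1)%N by rewrite -k'E.
have kE : inord k = k by rewrite inord_val.
have k'E' : inord k.+1 = k' by rewrite -k'E inord_val.
have prodE h : (forall i, i != k -> i != k' -> h i = g1 i) ->
    \prod_i h i = \prod_(0 <= i < k) g1 (inord i) * (h k * h k') *
                  \prod_(k.+2 <= i < n.+1) g1 (inord i).
  move=> hg; rewrite (prod_adjacent _ ltk) kE k'E'.
  have hgi i : (i < n.+1)%N -> i != k -> i != k.+1 -> h (inord i) = g1 (inord i).
    by move=> lti nik nik'; apply: hg; rewrite -val_eqE /= inordK ?k'E.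
  congr (_ * _ * _); apply: eq_big_nat => i /andP[lo hi].
    apply: hgi; first exact: ltn_trans hi (ltn_ord k).
      by rewrite ltn_eqF.
    by rewrite ltn_eqF // ltnW.
  by apply: hgi; rewrite ?gtn_eqF // ltnW.
rewrite !prodE //; first by rewrite -!mulrDl -!mulrDr g12.
all: by move=> i nk nk'; case: (gE i nk nk').
Qed.

(** Reindexes the permutations sending i to j by permutations of the remaining points, as the column
    expansion requires. *)
Lemma bij_lift_perm n (i j : 'I_n.+1) :
  {on [pred s : 'S_n.+1 | s i == j], bijective (lift_perm i j)}.
Proof.
pose low (s : 'S_n.+1) (k : 'I_n) := odflt k (unlift (s i) (s (lift i k))).
have lowK (s : 'S_n.+1) k : lift (s i) (low s k) = s (lift i k).
  rewrite /low; have [l ->//|/perm_inj/eqP] := unliftP (s i) (s (lift i k)).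
  by rewrite eq_sym (negPf (neq_lift i k)).
have low_inj (s : 'S_n.+1) : injective (low s).
  by move=> k l eq_kl; apply/(@lift_inj _ i)/(@perm_inj _ s); rewrite -!lowK eq_kl.
exists (fun s => perm (low_inj s)) => [s _|s /eqP si]; apply/permP => k.
  by rewrite permE /low lift_perm_id lift_perm_lift liftK.
have [l ->|->] := unliftP i k; last by rewrite lift_perm_id.
by rewrite lift_perm_lift permE -si lowK.
Qed.

(** [cons_B] is convertible to the instance with [B_index], so [sylvester_mx] is an instance of the
    general [sylvester] below. *)
Definition vcons (T : Type) s (x : T) (c : 'I_s -> T) (k : 'I_s.+1) : T :=
  if unlift ord0 k is Some k' then c k' else x.

Lemma vcons0 (T : Type) s (x : T) (c : 'I_s -> T) : vcons x c ord0 = x.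
Proof. by rewrite /vcons unlift_none. Qed.

Lemma vcons_lift (T : Type) s (x : T) (c : 'I_s -> T) k :
  vcons x c (lift ord0 k) = c k.
Proof. by rewrite /vcons liftK. Qed.

Lemma vcons_inj (T : eqType) s (x : T) (c : 'I_s -> T) :
  injective c -> (forall k, x != c k) -> injective (vcons x c).
Proof.
move=> inj_c ncx k l.
have [k' ->|->] := unliftP ord0 k; have [l' ->|->] := unliftP ord0 l;
  rewrite ?vcons0 ?vcons_lift.
- by move/inj_c->.
- by move/eqP; rewrite eq_sym (negPf (ncx _)).
- by move/eqP; rewrite (negPf (ncx _)).
- by [].
Qed.

Section QDet.
Variables (K : comNzRingType) (A : algType K).

(** Permutations are grouped by the image of the first column. The other factors have arguments u -
    1, u - 2, ..., whence the outer shift by 1. *)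
Lemma qdet_expand N (X : 'M[pseries A]_N.+1) :
  qdet X = \sum_(i < N.+1)
    (-1) ^+ i * (X i ord0 * shift 1 (qdet (row' i (col' ord0 X)))).
Proof.
rewrite {1}/qdet (partition_big (fun p : 'S_N.+1 => p ord0) predT) //=.
apply: eq_bigr => i _; rewrite (reindex _ (bij_lift_perm ord0 i)) /=.
rewrite raddf_sum !mulr_sumr; apply: eq_big => [s|s _].
  by rewrite lift_perm_id eqxx.
rewrite big_ord_recl /= lift_perm_id shift0 odd_lift_perm /= signr_addb signr_odd.
rewrite rmorphM rmorph_sign (mulrA (X i ord0)) (commr_sign (X i ord0)) -!mulrA.
congr (_ * (_ * (_ * _))).
rewrite rmorph_prod; apply: eq_bigr => k _.
by rewrite /= !mxE lift_perm_lift shift_shift -mulrS.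
Qed.

Lemma qdet_mx0 (X : 'M[pseries A]_0) : qdet X = 1.
Proof.
rewrite /qdet (big_pred1 1%g) ?odd_perm1 ?big_ord0 ?mul1r // => p.
by apply/esym/eqP/permP => -[].
Qed.

Lemma qdet_coef0 N (X : 'M[pseries A]_N) : unital X -> qdet X 0 = 1.
Proof.
elim: N X => [|N IHN] X X0; first by rewrite qdet_mx0.
rewrite qdet_expand pcoef_sum big_ord_recl big1 => [|i _].
  rewrite addr0 expr0 mul1r pcoefM0 X0 mul1r shift_coef0 IHN // => i j.
  by rewrite !mxE X0 (inj_eq lift_inj).
by rewrite pcoef_sign pcoefM0 X0 mul0r mulr0.
Qed.

Lemma comm_shift z c (f : pseries A) :
  GRing.comm (psC z) f -> GRing.comm (psC z) (shift c f).
Proof.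
move=> /comm_psCP zf; apply/comm_psCP => r; apply: commr_sum => s _.
by rewrite /GRing.comm -scalerAr -scalerAl zf.
Qed.

Lemma comm_qdet z N (X : 'M[pseries A]_N) :
  (forall i j, GRing.comm (psC z) (X i j)) -> GRing.comm (psC z) (qdet X).
Proof.
move=> zX; apply: commr_sum => p _; apply: commrM; first exact: commr_sign.
by apply: commr_prod => k _; exact: comm_shift.
Qed.

Section QMinor.
Variables (n : nat) (t : 'M[pseries A]_n).
Hypothesis rtt_t : rtt_series t.

Local Notation factor a b p k := (shift k%:R (t (a (p k)) (b k))).

Lemma qminorE s (a b : 'I_s -> 'I_n) :
  qminor t a b = \sum_(p : 'S_s) (-1) ^+ p * \prod_(k < s) factor a b p k.
Proof. by apply: eq_bigr => p _; congr (_ * _); apply: eq_bigr => k _; rewrite mxE. Qed.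

Lemma qminor_row_perm s (a b : 'I_s -> 'I_n) (q : 'S_s) :
  qminor t (a \o q) b = (-1) ^+ q * qminor t a b.
Proof.
rewrite !qminorE (reindex_inj (mulIg q^-1)%g) mulr_sumr; apply: eq_bigr => p _.
rewrite odd_permM odd_permV signr_addb mulrA -[in RHS]commr_sign; congr (_ * _).
by apply: eq_bigr => k _; rewrite /= permM permKV.
Qed.

(** In the sum of the two minors, the terms of p and [tperm k k' * p] cancel by [rtt_shift1_antisym]
    at the arguments u - k and u - k - 1. *)
Lemma qminor_col_adjacent s (a b : 'I_s -> 'I_n) (k k' : 'I_s) :
  k' = k.+1 :> nat -> qminor t a (b \o tperm k k') = - qminor t a b.
Proof.
move=> k'E; have nkk' : k != k' by rewrite -val_eqE /= k'E ltn_eqF.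
apply/eqP; rewrite -addr_eq0 addrC !qminorE -big_split /=; apply/eqP.
under eq_bigr => p _ do rewrite -mulrDr.
apply: (alternating_sum0 nkk') => p.
apply: esym; apply: (prod_adjacent_congr k'E) => [i nik nik'|] /=.
  by rewrite permM !tpermD // eq_sym.
rewrite !permM tpermL tpermR k'E [k.+1%:R]mulrSr -!shift_shift -!rmorphM -!rmorphD.
by rewrite (rtt_shift1_antisym rtt_t).
Qed.

(** Antisymmetry would only give that twice the minor is 0; [rtt_shift1_col] cancels the paired
    terms directly. *)
Lemma qminor_col_adjacent_eq s (a b : 'I_s -> 'I_n) (k k' : 'I_s) :
  k' = k.+1 :> nat -> b k = b k' -> qminor t a b = 0.
Proof.
move=> k'E bk; have nkk' : k != k' by rewrite -val_eqE /= k'E ltn_eqF.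
rewrite qminorE; apply: (alternating_sum0 nkk') => p.
set g := fun k : 'I_s => factor a b p k; apply: (addIr (\prod_(k < s) g k)).
apply: (prod_adjacent_congr k'E) => [i nik nik'|] /=.
  by rewrite /g permM !tpermD // eq_sym.
congr (_ + _); rewrite !permM tpermL tpermR bk k'E [k.+1%:R]mulrSr -!shift_shift.
by rewrite -!rmorphM (rtt_shift1_col rtt_t).
Qed.

Lemma qminor_col_perm s (a b : 'I_s -> 'I_n) (q : 'S_s) :
  qminor t a (b \o q) = (-1) ^+ q * qminor t a b.
Proof.
pose P (q : 'S_s) := forall b, qminor t a (b \o q) = (-1) ^+ q * qminor t a b.
have PM q1 q2 : P q1 -> P q2 -> P (q1 * q2)%g.
  move=> P1 P2 c; have -> : c \o (q1 * q2)%g = (c \o q2) \o q1.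
    by apply/funext => k; rewrite /= permM.
  by rewrite P1 P2 odd_permM signr_addb mulrA.
have Ptperm d (i j : 'I_s) : (j = i + d.+1 :> nat)%N -> P (tperm i j).
  elim: d j => [|d IHd] j jE.
    move=> c; rewrite qminor_col_adjacent ?jE ?addn1 // odd_tperm.
    by rewrite -val_eqE /= jE addn1 ltn_eqF // mulN1r.
  have lt_id : (i + d.+1 < s)%N by rewrite -addnS -jE ltnW.
  pose k := Ordinal lt_id.
  have Pkj : P (tperm k j).
    have kj : j = k.+1 :> nat by rewrite jE /= addnS.
    move=> c; rewrite qminor_col_adjacent // odd_tperm.
    by rewrite -val_eqE /= kj /= ltn_eqF // mulN1r.
  (* The transposition (i j) is the conjugate of (i k) by the adjacent transposition (k j), where k
     = j - 1. *)
  have -> : tperm i j = (tperm k j * (tperm i k * tperm k j))%g.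
    rewrite -{1}[tperm k j]tpermV.
    rewrite -[(_ * (_ * _))%g]/((tperm i k) ^ (tperm k j))%g tpermJ tpermL.
    by rewrite tpermD // -val_eqE /= ?jE gtn_eqF // -addn1 leq_add2l.
  by apply: (PM _ _ Pkj); apply: PM Pkj; exact: IHd.
have Pt (i j : 'I_s) : i != j -> P (tperm i j).
  rewrite -val_eqE /= neq_ltn => /orP[lt_ij|lt_ji].
    by apply: (Ptperm (j - i).-1); rewrite prednK ?subn_gt0 // subnKC // ltnW.
  rewrite tpermC.
  by apply: (Ptperm (i - j).-1); rewrite prednK ?subn_gt0 // subnKC // ltnW.
suff : P q by apply.
have [ts -> dts] := prod_tpermP q.
elim: ts dts => [_|[i j] ts IHts /= /andP[nij dts]].
  rewrite big_nil => c; rewrite odd_perm1 mul1r; congr (qminor t a _).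
  by apply/funext => k; rewrite /= perm1.
by rewrite big_cons; apply: PM; [exact: Pt | exact: IHts].
Qed.

Lemma qminor_col_eq s (a b : 'I_s -> 'I_n) (i j : 'I_s) :
  i != j -> b i = b j -> qminor t a b = 0.
Proof.
wlog lt_ij : i j / (i < j)%N => [IH nij bij|_ bij].
  have := nij; rewrite -val_eqE /= neq_ltn => /orP[lt|lt]; first exact: (IH i j).
  by apply: (IH j i) => //; rewrite eq_sym.
(* Column j is moved to position i + 1, next to its equal. *)
pose k := Ordinal (leq_ltn_trans lt_ij (ltn_ord j)).
apply: (can_inj (@signrMK _ (tperm k j))); rewrite mulr0 -qminor_col_perm.
apply: (@qminor_col_adjacent_eq _ _ _ i k) => //=.
by rewrite tpermL tpermD // -val_eqE /= ?gtn_eqF.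
Qed.

Lemma qminor_vcons_col_eq s (a : 'I_s.+1 -> 'I_n) (c : 'I_s -> 'I_n) k :
  qminor t a (vcons (c k) c) = 0.
Proof.
by apply: (@qminor_col_eq _ _ _ ord0 (lift ord0 k)); rewrite ?vcons0 ?vcons_lift.
Qed.

(** In the first-column expansion, j enters only through the entry of that column. Summation against
    V turns this entry into a Kronecker delta, and the rows in c contribute nothing since p is not
    among them. *)
Lemma inverse_qminor_vcons (V : 'M[pseries A]_n) s (c : 'I_s -> 'I_n) (i p : 'I_n) :
  V *m t^T = 1%:M -> (forall k, p != c k) ->
  \sum_j V p j * qminor t (vcons i c) (vcons j c) =
  shift 1 (qminor t c c) *+ (p == i).
Proof.
move=> Vt npc.
pose G (k : 'I_s.+1) := shift 1 (qdet (mxsub (vcons i c \o lift k) c t)).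
have qminor_vconsE j : qminor t (vcons i c) (vcons j c) =
    \sum_(k < s.+1) (-1) ^+ k * (t (vcons i c k) j * G k).
  rewrite /qminor qdet_expand; apply: eq_bigr => k _; rewrite !mxE vcons0.
  congr (_ * (_ * shift 1 (qdet _))); apply/matrixP => x y.
  by rewrite !mxE vcons_lift.
have VtE k : \sum_j V p j * t (vcons i c k) j = (p == vcons i c k)%:R.
  transitivity ((V *m t^T) p (vcons i c k)); last by rewrite Vt mxE.
  by rewrite mxE; apply: eq_bigr => j _; rewrite mxE.
transitivity (\sum_(k < s.+1) (-1) ^+ k * ((p == vcons i c k)%:R * G k)).
  under eq_bigr => j _ do rewrite qminor_vconsE mulr_sumr.
  rewrite exchange_big; apply: eq_bigr => k _ /=; rewrite -VtE mulr_suml mulr_sumr.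
  by apply: eq_bigr => j _; rewrite mulrA commr_sign -!mulrA.
rewrite big_ord_recl vcons0 expr0 mul1r big1 => [|k _].
  rewrite addr0 mulr_natl; congr (shift 1 (qdet _) *+ _).
  by apply/matrixP => x y; rewrite !mxE /= vcons_lift.
by rewrite vcons_lift (negPf (npc k)) mul0r mulr0.
Qed.

End QMinor.

Lemma qminor_bij s n (t : 'M[pseries A]_n) (w : 'I_s -> 'I_n) :
  rtt_series t -> bijective w -> qminor t w w = qdet t.
Proof.
move=> rtt_t bij_w; have sn : s = n by have := bij_eq_card bij_w; rewrite !card_ord.
subst s; have -> : w = id \o perm (bij_inj bij_w).
  by apply/funext => k; rewrite /= permE.
rewrite qminor_row_perm (qminor_col_perm rtt_t) mulrA -expr2 sqrr_sign mul1r.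
by rewrite /qminor mxsub_id.
Qed.

(** When c enumerates the complement of a, every summand with j != a is a minor with a repeated
    column. *)
Lemma inverse_diag_qdet n (t V : 'M[pseries A]_n.+1) (a : 'I_n.+1) :
  rtt_series t -> V *m t^T = 1%:M ->
  V a a * qdet t = shift 1 (qminor t (lift a) (lift a)).
Proof.
move=> rtt_t Vt.
have bij_a : bijective (vcons a (lift a)).
  apply: inj_card_bij; last by rewrite !card_ord.
  by apply: vcons_inj; [exact: lift_inj | exact: neq_lift].
rewrite -(qminor_bij rtt_t bij_a).
have := inverse_qminor_vcons a Vt (neq_lift a); rewrite eqxx mulr1n => <-.
rewrite (bigD1 a) //= big1 ?addr0 // => j; have [k -> _|->] := unliftP a j.
  by rewrite (qminor_vcons_col_eq rtt_t) mulr0.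
by rewrite eqxx.
Qed.

End QDet.

(** * Centrality of the quantum determinant *)

Section PsComm.
Variable A : nzRingType.
Implicit Types f g : pseries A.

Lemma pscomm_sym f g : pscomm f g -> pscomm g f.
Proof. by move=> fg r s; apply: commr_sym. Qed.

Lemma pscomm_psC f g : pscomm f g <-> forall s, GRing.comm (psC (g s)) f.
Proof.
split=> fg s; first by apply/comm_psCP => r; apply: commr_sym.
by move=> r; apply: commr_sym; have /comm_psCP := fg r.
Qed.

Lemma pscomm_comm f g : pscomm f g -> GRing.comm f g.
Proof.
move=> fg; apply: pseriesP => r; rewrite !pcoefM (reindex_inj rev_ord_inj) /=.
by apply: eq_bigr => i _; rewrite fg subSS subKn // -ltnS.
Qed.

(** If z commutes with P, then z P' = P' P z P' = P' z P P' = P' z. *)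
Lemma pscomm_inverse n (P P' : 'M[pseries A]_n) g :
  P' *m P = 1%:M -> P *m P' = 1%:M ->
  (forall i j, pscomm (P i j) g) -> forall i j, pscomm (P' i j) g.
Proof.
move=> P'P PP' Pg i j; apply/pscomm_psC => s; set z := psC (g s).
have zP : z%:M *m P = P *m z%:M.
  apply/matrixP => k l; rewrite scalar_mulmxE mulmx_scalarE.
  by have /pscomm_psC := Pg k l; apply.
have zP' : z%:M *m P' = P' *m z%:M.
  rewrite -[z%:M in LHS]mul1mx -P'P -!mulmxA (mulmxA P z%:M) -zP -!mulmxA PP'.
  by rewrite mulmx1.
have : (z%:M *m P') i j = (P' *m z%:M) i j by rewrite zP'.
by rewrite scalar_mulmxE mulmx_scalarE.
Qed.

End PsComm.

Section Centrality.
Variables (K : comNzRingType) (A : algType K).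
Implicit Types f g : pseries A.

Lemma shift_psC c (z : A) : shift c (psC z) = psC z.
Proof.
apply: pseriesP => r; rewrite (shift_widen _ _ (ltnSn r)) big_ord_recl expr0 pcoef1.
rewrite big1 ?addr0 => [|i _]; last by rewrite scaler0.
by case: r => [|r]; rewrite ?scale1r ?scale0r.
Qed.

Lemma pscomm_shift c f g : pscomm f g -> pscomm (shift c f) g.
Proof.
by move=> /pscomm_psC fg; apply/pscomm_psC => s; apply: comm_shift.
Qed.

Lemma pscomm_qdet N (X : 'M[pseries A]_N) g :
  (forall i j, pscomm (X i j) g) -> pscomm (qdet X) g.
Proof.
move=> Xg; apply/pscomm_psC => s; apply: comm_qdet => i j.
by have /pscomm_psC := Xg i j; apply.
Qed.

Lemma qdet_mx1 (X : 'M[pseries A]_1) : qdet X = X ord0 ord0.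
Proof. by rewrite qdet_expand big_ord1 mul1r qdet_mx0 rmorph1 mulr1. Qed.

Lemma qdet_mx2 (t : 'M[pseries A]_2) (i j : 'I_2) : rtt_series t -> i != j ->
  qdet t = t i i * shift 1 (t j j) - t j i * shift 1 (t i j).
Proof.
move=> rtt_t.
have q01 : qdet t = t ord0 ord0 * shift 1 (t (lift ord0 ord0) (lift ord0 ord0)) -
    t (lift ord0 ord0) ord0 * shift 1 (t ord0 (lift ord0 ord0)).
  rewrite qdet_expand !big_ord_recl big_ord0 addr0 mul1r /= expr1 mulN1r !qdet_mx1.
  rewrite !mxE; congr (_ - _ * shift 1 (t _ _)).
  by apply/val_inj.
have [k ->|->] := unliftP ord0 i; have [l ->|->] := unliftP ord0 j;
  rewrite ?eqxx ?[k]ord1 ?[l]ord1 ?eqxx // => _.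
rewrite q01; apply/eqP; rewrite subr_eq addrAC eq_sym subr_eq eq_sym; apply/eqP.
by rewrite (rtt_shift1_antisym rtt_t) addrC.
Qed.

(** The induction removes an index a different from i and j. When no such a exists, the rank is 1 or
    2 and the relations are used directly. *)
Lemma qdet_central n (t : 'M[pseries A]_n) : rtt_series t ->
  forall i j, pscomm (qdet t) (t i j).
Proof.
elim: n t => [|n IHn] t rtt_t i j; first by case: i.
have [V [Vt tV]] := unital_inv (unital_tr rtt_t.1).
(* [V a a] and the minor omitting a both commute with [t k l]; the former is cancelled from
   [inverse_diag_qdet]. *)
have cut a k l : k != a -> l != a -> pscomm (qdet t) (t k l).
  move=> nka nla.
  have qminor_kl : pscomm (qminor t (lift a) (lift a)) (t k l).
    have := IHn _ (rtt_series_sub (@lift_inj _ a) rtt_t).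
    case: (unliftP a k) nka => [k' -> _|->]; last by rewrite eqxx.
    case: (unliftP a l) nla => [l' -> _|->]; last by rewrite eqxx.
    by move=> /(_ k' l'); rewrite mxE.
  have Vkl : pscomm (V a a) (t k l) by apply: (tr_inv_pscomm rtt_t).
  have Vq := inverse_diag_qdet a rtt_t Vt.
  apply/pscomm_psC => s; set z := psC (t k l s).
  have zV : GRing.comm z (V a a) by have /pscomm_psC := Vkl; apply.
  have V0 : V a a 0 = 1.
    by rewrite (unital_linv (unital_tr rtt_t.1) Vt) eqxx.
  apply: (pseries_lreg V0); rewrite mulrA -zV -mulrA !(mulrA (V a a)) Vq.
  by have /(pscomm_shift 1) /pscomm_psC := qminor_kl; apply.
have [a /andP[nia nja]|nij] := pickP [pred a | (i != a) && (j != a)].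
  exact: (cut a).
have {nij} cover a : a \in [set i; j].
  by have := nij a; rewrite !inE /= (eq_sym a) (eq_sym a); case: eqP; case: eqP.
have /subset_leq_card : [set: 'I_n.+1] \subset [set i; j] by apply/subsetP => a _.
rewrite {cover} cardsT card_ord cards2; have [->|nij] := eqVneq i j => /=.
  rewrite ltnS leqn0 => /eqP n0; subst n => r s.
  by rewrite qdet_mx1 (ord1 j); apply: rtt_series_diag_comm.
(* In rank 2, no index a avoids {i, j}; there t_ij(v) = [t_ij^(1), t_jj(v)]. *)
rewrite ltnS => le_n1.
have n1 : n = 1%N.
  apply/eqP; rewrite eqn_leq le_n1 lt0n; apply: contra_neq nij => n0.
  by move: i j; rewrite n0 => i j; rewrite !ord1.
subst n; pose E := psC (t i j 1).
have E_gen k l : E * t k l - t k l * E = t i l *+ (k == j) - t k j *+ (i == l).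
  apply: pseriesP => s; rewrite pcoefD pcoefN pcoefCM pcoefMC rtt_gen1_comm //.
  by rewrite pcoefD pcoefN; case: (k == j); case: (i == l).
have shiftE : shift 1 E = E by exact: shift_psC.
have E_shift f : E * shift 1 f - shift 1 f * E = shift 1 (E * f - f * E).
  by rewrite rmorphB !rmorphM /= shiftE.
have E_mul f g : E * (f * g) - f * g * E = (E * f - f * E) * g + f * (E * g - g * E).
  by rewrite mulrBl mulrBr !mulrA addrA subrK.
have E_sub f g : E * (f - g) - (f - g) * E = (E * f - f * E) - (E * g - g * E).
  by rewrite mulrBr mulrBl !opprB addrACA [RHS]addrACA (addrC (- (E * g))).
(* The commutator with E is a derivation. On the 2 x 2 expansion it yields t_jj(u) t_ij(u-1) -
   t_ij(u) t_jj(u-1), which is 0 by [rtt_shift1_col]. *)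
have Eq : E * qdet t - qdet t * E = 0.
  rewrite (qdet_mx2 rtt_t nij) E_sub !E_mul !E_shift !E_gen.
  rewrite !eqxx (negPf nij) !mulr0n !mulr1n !(sub0r, subr0, oppr0) rmorph0 mulr0 addr0.
  rewrite mulNr mulrBl opprB -addrA [X in _ + X]addrC subrK.
  by rewrite (rtt_shift1_col rtt_t) addNr.
have qE r : GRing.comm (qdet t r) (t i j 1).
  have /comm_psCP : GRing.comm E (qdet t) by apply/eqP; rewrite -subr_eq0 Eq.
  by move=> Eqr; apply: commr_sym.
have qjj : pscomm (qdet t) (t j j) by apply: (cut i); rewrite eq_sym.
move=> r s; have := rtt_gen1_comm rtt_t i j j j s.
rewrite eqxx (negPf nij) mulr0n mulr1n subr0 => <-.
by apply: commrB; apply: commrM; first [exact: qE | exact: qjj].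
Qed.
End Centrality.

(** * The quantum Sylvester theorem *)

Section Sylvester.
Variables (K : comNzRingType) (A : algType K).

(** Arbitrary enumerations of A and B, since the induction on m passes to submatrices of t. *)
Definition complementary m s n (e : 'I_m -> 'I_n) (c : 'I_s -> 'I_n) :=
  [/\ injective e, injective c, forall i k, e i != c k &
      forall j, (j \in codom e) || (j \in codom c)].

Definition sylvester m s n (e : 'I_m -> 'I_n) (c : 'I_s -> 'I_n)
    (t : 'M[pseries A]_n) : 'M[pseries A]_m :=
  \matrix_(i, j) qminor t (vcons (e i) c) (vcons (e j) c).

Section Fixed.
Variables (m s n : nat) (e : 'I_m -> 'I_n) (c : 'I_s -> 'I_n).
Variables (t V : 'M[pseries A]_n).
Hypotheses (ec : complementary e c) (rtt_t : rtt_series t).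
Hypotheses (Vt : V *m t^T = 1%:M) (tV : t^T *m V = 1%:M).

Lemma inverse_sylvester :
  mxsub e e V *m (sylvester e c t)^T = (shift 1 (qminor t c c))%:M.
Proof.
have [inj_e inj_c nec cover] := ec.
apply/matrixP => i k; rewrite mxE [RHS]mxE -(inj_eq inj_e).
rewrite -(inverse_qminor_vcons (e k) Vt (nec i)).
(* An index j outside A lies in B, so its minor has a repeated column. *)
rewrite [RHS](bigID [in codom e]) /= [X in _ = _ + X]big1 ?addr0 => [|j nje].
  rewrite -big_uniq /= ?big_image /=; last by rewrite /codom map_inj_uniq ?enum_uniq.
  by apply: eq_bigr => j _; rewrite !mxE.
have := cover j; rewrite (negPf nje) => /codomP[l ->].
by rewrite (qminor_vcons_col_eq rtt_t) mulr0.
Qed.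

Lemma rtt_sylvester : rtt_series (sylvester e c t).
Proof.
have [inj_e inj_c nec cover] := ec.
set q := shift 1 (qminor t c c); pose VA := mxsub e e V.
have rtt_VA : rtt_series VA.
  exact: rtt_series_sub inj_e (rtt_series_tr_inv rtt_t Vt tV).
have [Y [YVA VAY]] := unital_inv rtt_VA.1.
have [Y0 Y_rel] := rtt_series_inv_tr rtt_VA YVA VAY.
have VAt k l i j : pscomm (VA i j) (t (c k) (c l)).
  by rewrite mxE; apply: (tr_inv_pscomm rtt_t) => //; rewrite eq_sym.
have Yq i j : pscomm (Y i j) q.
  apply: (pscomm_inverse YVA VAY) => k l; apply/pscomm_sym/pscomm_shift/pscomm_qdet.
  by move=> x y; rewrite mxE; exact/pscomm_sym/VAt.
(* [rtt_scale] requires q(u) and q(v) to commute; this comes from the centrality of the quantum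
   determinant of the submatrix indexed by c. *)
have qq : pscomm q q.
  have qt := qdet_central (rtt_series_sub inj_c rtt_t).
  do 2!apply/pscomm_sym/pscomm_shift.
  by apply: pscomm_qdet => k l; apply: pscomm_sym.
have sylE : sylvester e c t = Y^T *m q%:M.
  have sylT : (sylvester e c t)^T = Y *m q%:M.
    by rewrite -inverse_sylvester mulmxA YVA mul1mx.
  rewrite -[sylvester e c t]trmxK sylT; apply/matrixP => i j.
  by rewrite mxE !mulmx_scalarE mxE.
have syl0 : unital (sylvester e c t).
  move=> i j; rewrite sylE mulmx_scalarE pcoefM0 Y0 shift_coef0 qdet_coef0 ?mulr1 //.
  exact: (rtt_series_sub inj_c rtt_t).1.
split=> //; apply/(rtt_seriesP syl0); rewrite sylE !map_mxM !map_scalar_mx /=.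
apply: rtt_scale; last exact/(rtt_seriesP Y0).
- by move=> i j; rewrite !mxE; apply/pscommP/pscomm_sym.
- by move=> i j; rewrite !mxE; apply/commr_sym/pscommP.
- by move=> i j; rewrite !mxE /GRing.comm -!rmorphM (pscomm_comm (Yq _ _)).
- by move=> i j; rewrite !mxE /GRing.comm -!rmorphM (pscomm_comm (Yq _ _)).
- exact/pscommP.
Qed.

End Fixed.

Lemma complementary_lift m s n (e : 'I_m.+1 -> 'I_n.+1) (c : 'I_s -> 'I_n.+1) :
  complementary e c ->
  exists (e' : 'I_m -> 'I_n) (c' : 'I_s -> 'I_n),
    [/\ complementary e' c', forall i, e (lift ord0 i) = lift (e ord0) (e' i) &
        forall k, c k = lift (e ord0) (c' k)].
Proof.
move=> [inj_e inj_c nec cover]; set a := e ord0.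
have [e' e'E] : exists e' : 'I_m -> 'I_n, forall i, e (lift ord0 i) = lift a (e' i).
  apply: (fin_all_exists (P := fun i (x : 'I_n) => e (lift ord0 i) = lift a x)) => i;
   have [j ->|/inj_e/eqP] := unliftP a (e (lift ord0 i)).
    by exists j.
  by rewrite eq_sym (negPf (neq_lift _ _)).
have [c' c'E] : exists c' : 'I_s -> 'I_n, forall k, c k = lift a (c' k).
  apply: (fin_all_exists (P := fun k (x : 'I_n) => c k = lift a x)) => k;
   have [j ->|/eqP] := unliftP a (c k); first by exists j.
  by rewrite eq_sym (negPf (nec _ _)).
exists e', c'; split=> //; split=> [i j eq_ij|k l eq_kl|i k|j].
- by apply/(@lift_inj _ ord0)/inj_e; rewrite !e'E eq_ij.
- by apply/inj_c; rewrite !c'E eq_kl.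
- by rewrite -(inj_eq (@lift_inj _ a)) -e'E -c'E.
have /orP[/codomP[i ei]|/codomP[k ck]] := cover (lift a j).
  case: (unliftP ord0 i) ei => [i' ->|->].
    by rewrite e'E => /lift_inj->; rewrite codom_f.
  by move/eqP; rewrite eq_sym (negPf (neq_lift _ _)).
by move: ck; rewrite c'E => /lift_inj->; rewrite codom_f orbT.
Qed.

(** Induction on m deletes a = [e ord0]. With U the inverse of S^T, [inverse_sylvester] gives
    V_aa(u) = q(u-1) U_00(u), and [inverse_diag_qdet] is applied to both t and S. *)
Lemma qdet_sylvester m s n (e : 'I_m.+1 -> 'I_n) (c : 'I_s -> 'I_n) t :
  complementary e c -> rtt_series t ->
  qdet (sylvester e c t) =
  qdet t * \prod_(1 <= k < m.+1) shift k%:R (qminor t c c).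
Proof.
elim: m n e c t => [|m IHm] n e c t ec rtt_t.
  have [inj_e inj_c nec cover] := ec.
  rewrite qdet_mx1 mxE big_geq // mulr1; apply: (qminor_bij rtt_t).
  have inj_v : injective (vcons (e ord0) c) by exact: vcons_inj.
  apply: (inj_card_bij inj_v); rewrite -(card_codom inj_v) subset_leq_card //.
  apply/subsetP => j _; have /orP[/codomP[i ->]|/codomP[k ->]] := cover j.
    by apply/codomP; exists ord0; rewrite vcons0 (ord1 i).
  by apply/codomP; exists (lift ord0 k); rewrite vcons_lift.
case: n => [|n] in e c t ec rtt_t *; first by case: (e ord0).
have [e' [c' [ec' e'E c'E]]] := complementary_lift ec.
set a := e ord0 in e'E c'E; pose t' := mxsub (lift a) (lift a) t.
have rtt_t' : rtt_series t' := rtt_series_sub (@lift_inj _ a) rtt_t.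
set q := qminor t c c; set S := sylvester e c t.
have qE : qminor t' c' c' = q.
  by congr (qdet _); apply/matrixP => k l; rewrite !mxE !c'E.
(* Deleting the first row and column of S leaves minors that avoid a, hence the Sylvester matrix of
   t'. *)
have S'E : qminor S (lift ord0) (lift ord0) = qdet (sylvester e' c' t').
  congr (qdet _); apply/matrixP => i j; rewrite !mxE.
  congr (qdet _); apply/matrixP => k l; rewrite !mxE !e'E.
  have vconsE x x' y : x = lift a x' -> vcons x c y = lift a (vcons x' c' y).
    by move=> ->; rewrite /vcons; case: unlift.
  by rewrite !(vconsE _ _ _ (erefl _)).
have [V [Vt tV]] := unital_inv (unital_tr rtt_t.1).
have rtt_S : rtt_series S := rtt_sylvester ec rtt_t Vt tV.
have [U [US SU]] := unital_inv (unital_tr rtt_S.1).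
have VU : V a a = shift 1 q * U ord0 ord0.
  have VS : mxsub e e V *m S^T = (shift 1 q)%:M := inverse_sylvester ec rtt_t Vt.
  have : mxsub e e V ord0 ord0 = ((shift 1 q)%:M *m U) ord0 ord0.
    by rewrite -VS -mulmxA SU mulmx1.
  by rewrite mxE scalar_mulmxE.
have V0 : V a a 0 = 1 by rewrite (unital_linv (unital_tr rtt_t.1) Vt) eqxx.
(* After multiplication by V_aa, the left side is q(u-1) times the quantum determinant at u - 1 of
   the smaller Sylvester matrix, and the right side begins with qdet t'(u-1). *)
apply: (pseries_lreg V0); rewrite mulrA inverse_diag_qdet // -/t' -/(qdet _).
rewrite {1}VU -mulrA inverse_diag_qdet // S'E (IHm _ _ _ _ ec' rtt_t') qE.
rewrite rmorphM mulrA.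
(* q is a quantum determinant in entries of t', so it commutes with the central series qdet t'. *)
have -> : shift 1 q * shift 1 (qdet t') = shift 1 (qdet t') * shift 1 q.
  rewrite -!rmorphM; congr (shift 1 _); apply/pscomm_comm/pscomm_sym.
  rewrite -qE; apply: pscomm_sym; apply: pscomm_qdet => k l.
  by apply: pscomm_sym; rewrite mxE; exact: qdet_central.
rewrite -mulrA; congr (_ * _); rewrite [RHS]big_ltn // rmorph_prod; congr (_ * _).
rewrite [RHS]big_add1; apply: eq_bigr => k _.
by rewrite /= shift_shift -mulrS.
Qed.

Lemma shift_qdet (z : K) N (X : 'M[pseries A]_N) :
  shift z (qdet X) = qdet (map_mx (shift z) X).
Proof.
rewrite /qdet raddf_sum; apply: eq_bigr => p _ /=.
rewrite rmorphM rmorph_sign rmorph_prod; congr (_ * _); apply: eq_bigr => k _.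
by rewrite mxE /= !shift_shift addrC.
Qed.

End Sylvester.

(** * Application to the generator matrix of the Yangian *)

Theorem theorem1p3 (R : realType) (m n : nat) (m_gt0 : (0 < m)%N)
    (lemn : (m <= n)%N) :
  (exists phi : {lrmorphism yangian R[i] m -> yangian R[i] n},
     forall i j : 'I_m,
       map_pseries phi (yangian_mx R[i] m i j) = sylvester_mx R[i] lemn i j)
  /\ qdet (sylvester_mx R[i] lemn) =
     qdet (yangian_mx R[i] n) *
     \prod_(1 <= k < m)
        qdet (map_mx (shift (k%:R : R[i])) (yangian_BB R[i] lemn)).
Proof.
have rtt_t : rtt_series (yangian_mx R[i] n).
  by split=> *; [exact: yangian_mx0 | exact: yangian_relP].
have ec : complementary (widen_ord lemn) (B_index lemn).
  split=> [i j|i j|i k|j].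
  - by move=> /(congr1 val) /= ij; exact/val_inj.
  - by move=> /cast_ord_inj/rshift_inj.
  - by rewrite -val_eqE /= ltn_eqF // ltn_addr.
  have [lt_jm|le_mj] := ltnP j m.
    by apply/orP; left; apply/codomP; exists (Ordinal lt_jm); exact/val_inj.
  have lt_jmn : (j - m < n - m)%N by rewrite ltn_sub2r // (leq_ltn_trans le_mj).
  apply/orP; right; apply/codomP; exists (Ordinal lt_jmn); apply/val_inj.
  by rewrite /= subnKC.
have [V [Vt tV]] := unital_inv (unital_tr rtt_t.1).
have [syl0 syl_rel] := rtt_sylvester ec rtt_t Vt tV.
split; first exact: (yangian_lift syl0 syl_rel).
case: m m_gt0 lemn ec syl0 syl_rel => // m _ lemn ec _ _.
rewrite -/(sylvester _ _ _) (qdet_sylvester ec rtt_t); congr (_ * _).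
by apply: eq_bigr => k _; rewrite shift_qdet.
Qed.
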